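(* Let $\mathcal{C}$ be a closed monoidal category with countable colimits, $(P,Q)$ a pivotal pair in $\mathcal{C}$ with duality morphisms $\mathrm{coev},\mathrm{ev},\underline{\mathrm{coev}},\underline{\mathrm{ev}}$, and let $T=UF$ be the Hopf monad on $\mathcal{C}$ induced by the adjunction $F\dashv U:\mathcal{C}(P,Q)\rightleftarrows\mathcal{C}$, where $U$ is the forgetful functor. Then $T$ is augmented if and only if there exist braidings $\lambda:P\otimes\mathrm{id}_{\mathcal{C}}\Rightarrow\mathrm{id}_{\mathcal{C}}\otimes P$ and $\chi:Q\otimes\mathrm{id}_{\mathcal{C}}\Rightarrow\mathrm{id}_{\mathcal{C}}\otimes Q$ such that $(P,\lambda)$ and $(Q,\chi)$ are objects of the center $Z(\mathcal{C})$ and $\mathrm{coev},\mathrm{ev},\underline{\mathrm{coev}},\underline{\mathrm{ev}}$ are morphisms in $Z(\mathcal{C})$, making $(P,\lambda)$ and $(Q,\chi)$ a pivotal pair in $Z(\mathcal{C})$.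
   Context: Monoidal categories $(\mathcal{C},\otimes,\mathbf 1)$ are assumed strict; object names also denote identity morphisms. Closed means that all $-\otimes A$ and $A\otimes-$ have right adjoints. A pivotal pair $(P,Q)$ in a monoidal category consists of objects $P,Q$ with morphisms $\mathrm{coev}:\mathbf 1\to P\otimes Q$, $\mathrm{ev}:Q\otimes P\to\mathbf 1$ making $Q$ a left dual of $P$, i.e. $(\mathrm{ev}\otimes Q)(Q\otimes\mathrm{coev})=\mathrm{id}_Q$, $(P\otimes\mathrm{ev})(\mathrm{coev}\otimes P)=\mathrm{id}_P$, and morphisms $\underline{\mathrm{coev}}:\mathbf 1\to Q\otimes P$, $\underline{\mathrm{ev}}:P\otimes Q\to\mathbf 1$ making $Q$ a right dual of $P$, i.e. $(\underline{\mathrm{ev}}\otimes P)(P\otimes\underline{\mathrm{coev}})=\mathrm{id}_P$, $(Q\otimes\underline{\mathrm{ev}})(\underline{\mathrm{coev}}\otimes Q)=\mathrm{id}_Q$. The category $\mathcal{C}(P,Q)$: objects are pairs $(X,\sigma)$ with $X$ an object of $\mathcal{C}$ and $\sigma:X\otimes P\to P\otimes X$ an invertible morphism such that the two morphisms $$(\mathrm{ev}\otimes X\otimes Q)(Q\otimes\sigma\otimes Q)(Q\otimes X\otimes\mathrm{coev}):Q\otimes X\to X\otimes Q,$$ $$(Q\otimes X\otimes\underline{\mathrm{ev}})(Q\otimes\sigma^{-1}\otimes Q)(\underline{\mathrm{coev}}\otimes X\otimes Q):X\otimes Q\to Q\otimes X$$ are inverse to each other. Morphisms $(X,\sigma)\to(Y,\tau)$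 are morphisms $f:X\to Y$ in $\mathcal{C}$ with $\tau(f\otimes P)=(P\otimes f)\sigma$. It is monoidal via $(X,\sigma)\otimes(Y,\tau)=(X\otimes Y,(\sigma\otimes Y)(X\otimes\tau))$ with unit $(\mathbf 1,\mathrm{id}_P)$; the forgetful functor $U(X,\sigma)=X$ is strict monoidal. The monad $T$: under the stated hypotheses on $\mathcal{C}$, $U$ has a left adjoint $F$, with unit $\nu:\mathrm{id}_{\mathcal{C}}\Rightarrow UF$ and counit $\theta:FU\Rightarrow\mathrm{id}$. The monad is $T=UF$ with multiplication $\mu=U\theta_F$ and unit $\nu$; its comonoidal structure, induced by the strict monoidal functor $U$, is $T_2(X,Y)=U\theta_{F(X)\otimes F(Y)}\circ T(\nu_X\otimes\nu_Y):T(X\otimes Y)\to T(X)\otimes T(Y)$ and $T_0=U\theta_{(\mathbf 1,\mathrm{id}_P)}:T(\mathbf 1)\to\mathbf 1$. With this structure $T$ is a Hopf monad (a monad with compatible comonoidal structure and invertible fusion operators). Augmented: a Hopf monad $(T,\mu,\nu,T_2,T_0)$ is augmented if there exists a bimonad morphism $\xi:T\Rightarrow\mathrm{id}_{\mathcal{C}}$, i.e. a natural transformation with $\xi\nu=\mathrm{id}$, $\xi\mu=\xi T(\xi)$, $(\xi_X\otimes\xi_Y)T_2(X,Y)=\xi_{X\otimes Y}$ and $\xi_{\mathbf 1}=T_0$. Center $Z(\mathcal{C})$: objects are pairs $(X,\tau)$ with $\tau:X\otimes-\Rightarrow-\otimes X$ a natural isomorphism (braiding) satisfying $\tau_{\mathbf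 1}=\mathrm{id}_X$ and $(M\otimes\tau_N)(\tau_M\otimes N)=\tau_{M\otimes N}$; morphisms $(X,\tau)\to(Y,\nu)$ are morphisms $f:X\to Y$ with $(\mathrm{id}\otimes f)\tau=\nu(f\otimes\mathrm{id})$; tensor product $(X,\tau)\otimes(Y,\nu)=(X\otimes Y,(\tau\otimes Y)(X\otimes\nu))$, unit $(\mathbf 1,\mathrm{id})$. *)

(* Defs.v *)
From Stdlib Require Import ClassicalEpsilon FunctionalExtensionality
  ProofIrrelevance.
From Corelib Require Import ssreflect ssrfun ssrbool.

Set Implicit Arguments.
Unset Strict Implicit.
Unset Printing Implicit Defensive.

(* Categories are presented by one sort of objects and one sort of morphisms
   with domain and codomain maps, so that the laws of a strict monoidal
   category are plain equalities between morphisms, without transport along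
   equalities of objects.  [comp g f] is "g after f"; it is a total function,
   but it is only constrained (and only used) when [dom g = cod f]. *)
Record category := Category {
  ob : Type;
  mor : Type;
  dom : mor -> ob;
  cod : mor -> ob;
  idm : ob -> mor;
  comp : mor -> mor -> mor;
  dom_idm : forall x, dom (idm x) = x;
  cod_idm : forall x, cod (idm x) = x;
  dom_comp : forall g f, dom g = cod f -> dom (comp g f) = dom f;
  cod_comp : forall g f, dom g = cod f -> cod (comp g f) = cod g;
  comp1m : forall f, comp (idm (cod f)) f = f;
  compm1 : forall f, comp f (idm (dom f)) = f;
  compA : forall h g f, dom h = cod g -> dom g = cod f ->
    comp h (comp g f) = comp (comp h g) f
}.

Declare Scope ob_scope.
Declare Scope mor_scope.
Delimit Scope ob_scope with ob.
Delimit Scope mor_scope with mor.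
Bind Scope ob_scope with ob.
Bind Scope mor_scope with mor.
Arguments dom {c} f%_mor : rename.
Arguments cod {c} f%_mor : rename.
Arguments idm {c} x%_ob : rename.
Arguments comp {c} g%_mor f%_mor : rename.

(* Object names also denote identity morphisms. *)
Coercion idm : ob >-> mor.

Notation "g ∘ f" := (comp g f)
  (at level 45, left associativity) : mor_scope.
Open Scope mor_scope.

Definition arrow (C : category) (x y : ob C) (f : mor C) : Prop :=
  dom f = x /\ cod f = y.

Definition inverse (C : category) (x y : ob C) (f g : mor C) : Prop :=
  [/\ arrow x y f, arrow y x g, g ∘ f = x & f ∘ g = y].

Definition invertible (C : category) (f : mor C) : Prop :=
  exists g, inverse (dom f) (cod f) f g.

Record functor (C D : category) := Functor {
  fob :> ob C -> ob D;
  fmor : mor C -> mor D;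
  dom_fmor : forall f, dom (fmor f) = fob (dom f);
  cod_fmor : forall f, cod (fmor f) = fob (cod f);
  fmor_id : forall x : ob C, fmor x = fob x;
  fmor_comp : forall g f, dom g = cod f -> fmor (g ∘ f) = fmor g ∘ fmor f
}.

Program Definition id_functor (C : category) : functor C C :=
  @Functor C C (fun x => x) (fun f => f) _ _ _ _.

Program Definition comp_functor (C D E : category)
    (G : functor D E) (F : functor C D) : functor C E :=
  @Functor C E (fun x => G (F x)) (fun f => fmor G (fmor F f)) _ _ _ _.
Next Obligation. by rewrite !dom_fmor. Qed.
Next Obligation. by rewrite !cod_fmor. Qed.
Next Obligation. by rewrite !fmor_id. Qed.
Next Obligation. by rewrite !fmor_comp // dom_fmor cod_fmor H. Qed.

Record nat_trans (C D : category) (F G : functor C D) (eta : ob C -> mor D) :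
    Prop := NatTrans {
  nt_arrow : forall x, arrow (F x) (G x) (eta x);
  nt_natural : forall f, eta (cod f) ∘ fmor F f = fmor G f ∘ eta (dom f)
}.

Definition nat_iso (C D : category) (F G : functor C D)
    (eta : ob C -> mor D) : Prop :=
  nat_trans F G eta /\ forall x, invertible (eta x).

Record adjunction (C D : category) (F : functor C D) (U : functor D C) :=
    Adjunction {
  adj_unit : ob C -> mor C;
  adj_counit : ob D -> mor D;
  adj_unit_nat : nat_trans (id_functor C) (comp_functor U F) adj_unit;
  adj_counit_nat : nat_trans (comp_functor F U) (id_functor D) adj_counit;
  adj_triangle_l : forall x : ob C,
    adj_counit (F x) ∘ fmor F (adj_unit x) = F x;
  adj_triangle_r : forall a : ob D,
    fmor U (adj_counit a) ∘ adj_unit (U a) = U a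
}.

Definition has_right_adjoint (C D : category) (F : functor C D) : Prop :=
  exists U : functor D C, inhabited (adjunction F U).

Definition cocone (J C : category) (D : functor J C) (c : ob C)
    (i : ob J -> mor C) : Prop :=
  (forall j, arrow (D j) c (i j)) /\
  (forall u, i (cod u) ∘ fmor D u = i (dom u)).

Definition is_colimit (J C : category) (D : functor J C) (c : ob C)
    (i : ob J -> mor C) : Prop :=
  cocone D c i /\
  forall d k, cocone D d k ->
    exists! h, arrow c d h /\ forall j, h ∘ i j = k j.

(* Finite categories are included; countably many morphisms force countably
   many objects. *)
Definition countable_category (J : category) : Prop :=
  exists e : mor J -> nat, injective e.

Definition has_countable_colimits (C : category) : Prop :=
  forall (J : category) (D : functor J C), countable_category J ->
    exists c i, is_colimit D c i.

Record smcat := SMCat {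
  smc :> category;
  tob : ob smc -> ob smc -> ob smc;
  tmor : mor smc -> mor smc -> mor smc;
  tunit : ob smc;
  dom_tmor : forall f g, dom (tmor f g) = tob (dom f) (dom g);
  cod_tmor : forall f g, cod (tmor f g) = tob (cod f) (cod g);
  tmor_id : forall x y : ob smc, tmor x y = tob x y;
  tmor_comp : forall g f g' f', dom g = cod f -> dom g' = cod f' ->
    tmor (g ∘ f) (g' ∘ f') = tmor g g' ∘ tmor f f';
  tobA : forall x y z, tob x (tob y z) = tob (tob x y) z;
  tob1x : forall x, tob tunit x = x;
  tobx1 : forall x, tob x tunit = x;
  tmorA : forall f g h, tmor f (tmor g h) = tmor (tmor f g) h;
  tmor1m : forall f, tmor tunit f = f;
  tmorm1 : forall f, tmor f tunit = f
}.

Arguments tob {s} x%_ob y%_ob : rename.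
Arguments tmor {s} f%_mor g%_mor : rename.
Arguments tunit {s}.

Notation "x ⊗ y" := (tob x y) (at level 40, left associativity) : ob_scope.
Notation "f ⊗ g" := (tmor f g) (at level 40, left associativity) : mor_scope.
Notation "𝟏" := tunit : ob_scope.

Record smfunctor (D C : smcat) := SMFunctor {
  smf :> functor D C;
  smf_ob : forall a b, smf (a ⊗ b)%ob = (smf a ⊗ smf b)%ob;
  smf_mor : forall f g, fmor smf (f ⊗ g) = fmor smf f ⊗ fmor smf g;
  smf_unit : smf 𝟏%ob = 𝟏%ob
}.

Ltac objs := rewrite ?tob1x ?tobx1 ?tobA ?tob1x ?tobx1.

Ltac ty_step := match goal with
  | |- context [dom (idm _)] => rewrite dom_idm
  | |- context [cod (idm _)] => rewrite cod_idm
  | |- context [dom (tmor _ _)] => rewrite dom_tmor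
  | |- context [cod (tmor _ _)] => rewrite cod_tmor
  | |- context [dom (fmor _ _)] => rewrite dom_fmor
  | |- context [cod (fmor _ _)] => rewrite cod_fmor
  | H : dom ?f = _ |- context [dom ?f] => rewrite H
  | H : cod ?f = _ |- context [cod ?f] => rewrite H
  end.

Ltac ty := repeat (progress (
    repeat ty_step;
    try match goal with
    | |- context [dom (comp ?g ?f)] =>
        rewrite (@dom_comp _ g f ltac:(ty))
    | |- context [cod (comp ?g ?f)] =>
        rewrite (@cod_comp _ g f ltac:(ty))
    end)); objs; try reflexivity.

Lemma comp_id_l (C : category) (f : mor C) y : cod f = y -> idm y ∘ f = f.
Proof. by move=> <-; apply: comp1m. Qed.

Lemma comp_id_r (C : category) (f : mor C) x : dom f = x -> f ∘ idm x = f.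
Proof. by move=> <-; apply: compm1. Qed.

Lemma tens_comp_l (C : smcat) (x : ob C) (g f : mor C) : dom g = cod f ->
  x ⊗ (g ∘ f) = (x ⊗ g) ∘ (x ⊗ f).
Proof.
move=> e; rewrite -tmor_comp ?dom_idm ?cod_idm //.
by rewrite comp_id_l ?cod_idm.
Qed.

Lemma tens_comp_r (C : smcat) (x : ob C) (g f : mor C) : dom g = cod f ->
  (g ∘ f) ⊗ x = (g ⊗ x) ∘ (f ⊗ x).
Proof.
move=> e; rewrite -tmor_comp ?dom_idm ?cod_idm //.
by rewrite comp_id_l ?cod_idm.
Qed.

Lemma exchange (C : smcat) (f g : mor C) :
  (cod f ⊗ g) ∘ (f ⊗ dom g) = (f ⊗ cod g) ∘ (dom f ⊗ g).
Proof. by rewrite -!tmor_comp ?dom_idm ?cod_idm // !comp1m !compm1. Qed.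

Program Definition tensor_left (C : smcat) (a : ob C) : functor C C :=
  @Functor C C (fun x => a ⊗ x)%ob (fun f => a ⊗ f) _ _ _ _.
Next Obligation. by ty. Qed.
Next Obligation. by ty. Qed.
Next Obligation. exact: tmor_id. Qed.
Next Obligation. exact: tens_comp_l. Qed.

Program Definition tensor_right (C : smcat) (a : ob C) : functor C C :=
  @Functor C C (fun x => x ⊗ a)%ob (fun f => f ⊗ a) _ _ _ _.
Next Obligation. by ty. Qed.
Next Obligation. by ty. Qed.
Next Obligation. exact: tmor_id. Qed.
Next Obligation. exact: tens_comp_r. Qed.

Definition closed (C : smcat) : Prop :=
  forall a : ob C, has_right_adjoint (tensor_right a) /\
                   has_right_adjoint (tensor_left a).

Record pivotal_pair (C : smcat) (P Q : ob C) (coev ev rcoev rev : mor C) :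
    Prop := PivotalPair {
  coev_arrow : arrow 𝟏 (P ⊗ Q) coev;
  ev_arrow : arrow (Q ⊗ P) 𝟏 ev;
  left_dual_Q : (ev ⊗ Q) ∘ (Q ⊗ coev) = Q;
  left_dual_P : (P ⊗ ev) ∘ (coev ⊗ P) = P;
  rcoev_arrow : arrow 𝟏 (Q ⊗ P) rcoev;
  rev_arrow : arrow (P ⊗ Q) 𝟏 rev;
  right_dual_P : (rev ⊗ P) ∘ (P ⊗ rcoev) = P;
  right_dual_Q : (Q ⊗ rev) ∘ (rcoev ⊗ Q) = Q
}.

(* [sto_hom a b f] says that [f] is a morphism from [a] to [b].  Both
   C(P,Q) and the center are obtained from such data. *)
Record structure_over (C : smcat) := StructureOver {
  sto_ob : Type;
  sto_forget : sto_ob -> ob C;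
  sto_hom : sto_ob -> sto_ob -> mor C -> Prop;
  sto_tens : sto_ob -> sto_ob -> sto_ob;
  sto_unit : sto_ob;
  sto_arrow : forall a b f, sto_hom a b f ->
    arrow (sto_forget a) (sto_forget b) f;
  sto_id : forall a, sto_hom a a (sto_forget a);
  sto_comp : forall a b c g f, sto_hom b c g -> sto_hom a b f ->
    sto_hom a c (g ∘ f);
  sto_tmor : forall a b a' b' f f', sto_hom a b f -> sto_hom a' b' f' ->
    sto_hom (sto_tens a a') (sto_tens b b') (f ⊗ f');
  sto_forget_tens : forall a b,
    sto_forget (sto_tens a b) = (sto_forget a ⊗ sto_forget b)%ob;
  sto_forget_unit : sto_forget sto_unit = 𝟏%ob;
  sto_tensA : forall a b c,
    sto_tens a (sto_tens b c) = sto_tens (sto_tens a b) c;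
  sto_tens1x : forall a, sto_tens sto_unit a = a;
  sto_tensx1 : forall a, sto_tens a sto_unit = a
}.

Record sto_mor (C : smcat) (S : structure_over C) := StoMor {
  sm_dom : sto_ob S;
  sm_cod : sto_ob S;
  sm_mor : mor C;
  sm_hom : sto_hom sm_dom sm_cod sm_mor
}.

Lemma sto_mor_eq (C : smcat) (S : structure_over C) (f g : sto_mor S) :
  sm_dom f = sm_dom g -> sm_cod f = sm_cod g -> sm_mor f = sm_mor g -> f = g.
Proof.
case: f g => [a b f Hf] [a' b' f' Hf'] /= e1 e2 e3; subst.
by congr StoMor; apply: proof_irrelevance.
Qed.

Definition sto_idm (C : smcat) (S : structure_over C) (a : sto_ob S) :=
  StoMor (sto_id a).

(* The value on non-composable pairs is irrelevant. *)
Definition sto_mcomp (C : smcat) (S : structure_over C) (g f : sto_mor S) :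
    sto_mor S :=
  match excluded_middle_informative (sm_cod f = sm_dom g) with
  | left e => StoMor (sto_comp (sm_hom g)
                (eq_ind _ (fun b => sto_hom (sm_dom f) b (sm_mor f))
                   (sm_hom f) _ e))
  | right _ => g
  end.

Lemma sto_mcompE (C : smcat) (S : structure_over C) (g f : sto_mor S) :
  sm_dom g = sm_cod f ->
  [/\ sm_dom (sto_mcomp g f) = sm_dom f, sm_cod (sto_mcomp g f) = sm_cod g &
      sm_mor (sto_mcomp g f) = sm_mor g ∘ sm_mor f].
Proof.
by rewrite /sto_mcomp => e; case: excluded_middle_informative => // n; case: n.
Qed.

Definition sto_mtens (C : smcat) (S : structure_over C) (f g : sto_mor S) :=
  StoMor (sto_tmor (sm_hom f) (sm_hom g)).

Lemma sm_domE (C : smcat) (S : structure_over C) (f : sto_mor S) :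
  dom (sm_mor f) = sto_forget (sm_dom f).
Proof. by case: (sto_arrow (sm_hom f)). Qed.

Lemma sm_codE (C : smcat) (S : structure_over C) (f : sto_mor S) :
  cod (sm_mor f) = sto_forget (sm_cod f).
Proof. by case: (sto_arrow (sm_hom f)). Qed.

Program Definition sto_category (C : smcat) (S : structure_over C) :
    category :=
  @Category (sto_ob S) (sto_mor S) (@sm_dom C S) (@sm_cod C S) (@sto_idm C S)
    (@sto_mcomp C S) _ _ _ _ _ _ _.
Next Obligation. by case: (sto_mcompE H). Qed.
Next Obligation. by case: (sto_mcompE H). Qed.
Next Obligation.
have [d c m] := @sto_mcompE C S (sto_idm (sm_cod f)) f erefl.
by apply: sto_mor_eq => //; rewrite m /= comp_id_l // sm_codE.
Qed.
Next Obligation.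
have [d c m] := @sto_mcompE C S f (sto_idm (sm_dom f)) erefl.
by apply: sto_mor_eq => //; rewrite m /= comp_id_r // sm_domE.
Qed.
Next Obligation.
have [d1 c1 m1] := sto_mcompE H; have [d2 c2 m2] := sto_mcompE H0.
have [|d3 c3 m3] := @sto_mcompE C S h (sto_mcomp g f); first by rewrite c2.
have [|d4 c4 m4] := @sto_mcompE C S (sto_mcomp h g) f; first by rewrite d1.
apply: sto_mor_eq; rewrite ?d3 ?d4 ?c3 ?c4 ?d2 ?c1 // m3 m4 m1 m2 compA //.
- by rewrite sm_domE sm_codE H.
- by rewrite sm_domE sm_codE H0.
Qed.

Program Definition sto_smcat (C : smcat) (S : structure_over C) : smcat :=
  @SMCat (sto_category S) (@sto_tens C S) (@sto_mtens C S) (sto_unit S)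
    _ _ _ _ _ _ _ _ _ _.
Next Obligation.
by apply: sto_mor_eq => //=; rewrite tmor_id sto_forget_tens.
Qed.
Next Obligation.
have [d1 c1 m1] := sto_mcompE H; have [d2 c2 m2] := sto_mcompE H0.
have [|d3 c3 m3] := @sto_mcompE C S (sto_mtens g g') (sto_mtens f f').
  by rewrite /= H H0.
apply: sto_mor_eq; rewrite ?d3 ?c3 ?m3 /= ?d1 ?d2 ?c1 ?c2 ?m1 ?m2 //.
by rewrite tmor_comp // sm_domE sm_codE ?H ?H0.
Qed.
Next Obligation. exact: sto_tensA. Qed.
Next Obligation. exact: sto_tens1x. Qed.
Next Obligation. exact: sto_tensx1. Qed.
Next Obligation. by apply: sto_mor_eq; rewrite /= ?sto_tensA ?tmorA. Qed.
Next Obligation.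
by apply: sto_mor_eq; rewrite /= ?sto_tens1x // sto_forget_unit tmor1m.
Qed.
Next Obligation.
by apply: sto_mor_eq; rewrite /= ?sto_tensx1 // sto_forget_unit tmorm1.
Qed.

Program Definition sto_forget_functor (C : smcat) (S : structure_over C) :
    functor (sto_smcat S) C :=
  @Functor (sto_smcat S) C (@sto_forget C S) (@sm_mor C S) _ _ _ _.
Next Obligation. exact: sm_domE. Qed.
Next Obligation. exact: sm_codE. Qed.
Next Obligation. by case: (sto_mcompE H). Qed.

Program Definition sto_smfunctor (C : smcat) (S : structure_over C) :
    smfunctor (sto_smcat S) C :=
  @SMFunctor (sto_smcat S) C (sto_forget_functor S) _ _ _.
Next Obligation. exact: sto_forget_tens. Qed.
Next Obligation. exact: sto_forget_unit. Qed.

Definition Qbraid (C : smcat) (Q : ob C) (coev ev : mor C) (X : ob C)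
    (s : mor C) : mor C :=
  (ev ⊗ X ⊗ Q) ∘ (Q ⊗ s ⊗ Q) ∘ (Q ⊗ X ⊗ coev).

Definition Qbraid_inv (C : smcat) (Q : ob C) (rcoev rev : mor C) (X : ob C)
    (s' : mor C) : mor C :=
  (Q ⊗ X ⊗ rev) ∘ (Q ⊗ s' ⊗ Q) ∘ (rcoev ⊗ X ⊗ Q).

Definition is_cpq (C : smcat) (P Q : ob C) (coev ev rcoev rev : mor C)
    (X : ob C) (s : mor C) : Prop :=
  exists s', inverse (X ⊗ P) (P ⊗ X) s s' /\
    inverse (Q ⊗ X) (X ⊗ Q) (Qbraid Q coev ev X s)
      (Qbraid_inv Q rcoev rev X s').

Record cpq_ob (C : smcat) (P Q : ob C) (coev ev rcoev rev : mor C) := CpqOb {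
  cpq_carrier : ob C;
  cpq_sigma : mor C;
  cpq_law : is_cpq P Q coev ev rcoev rev cpq_carrier cpq_sigma
}.

Definition cpq_hom (C : smcat) (P Q : ob C) (coev ev rcoev rev : mor C)
    (a b : cpq_ob P Q coev ev rcoev rev) (f : mor C) : Prop :=
  arrow (cpq_carrier a) (cpq_carrier b) f /\
  cpq_sigma b ∘ (f ⊗ P) = (P ⊗ f) ∘ cpq_sigma a.

Lemma cpq_ob_eq (C : smcat) (P Q : ob C) (coev ev rcoev rev : mor C)
    (a b : cpq_ob P Q coev ev rcoev rev) :
  cpq_carrier a = cpq_carrier b -> cpq_sigma a = cpq_sigma b -> a = b.
Proof.
case: a b => [a s Hs] [b t Ht] /= e1 e2; subst.
by congr CpqOb; apply: proof_irrelevance.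
Qed.

(* [Qbraid] is characterised as a mate of [s], and [Qbraid_inv] as a mate of
   [s']; this gives their compatibility with the tensor product. *)
Lemma Qbraid_arrow (C : smcat) (P Q : ob C) (coev ev rcoev rev : mor C) X s :
  pivotal_pair P Q coev ev rcoev rev -> arrow (X ⊗ P) (P ⊗ X) s ->
  arrow (Q ⊗ X) (X ⊗ Q) (Qbraid Q coev ev X s).
Proof.
move=> [[d1 c1] [d2 c2] _ _ _ _ _ _] [ds cs].
by rewrite /Qbraid; split; ty.
Qed.

Lemma Qbraid_inv_arrow (C : smcat) (P Q : ob C) (coev ev rcoev rev : mor C)
    X s :
  pivotal_pair P Q coev ev rcoev rev -> arrow (P ⊗ X) (X ⊗ P) s ->
  arrow (X ⊗ Q) (Q ⊗ X) (Qbraid_inv Q rcoev rev X s).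
Proof.
move=> [_ _ _ _ [d1 c1] [d2 c2] _ _] [ds cs].
by rewrite /Qbraid_inv; split; ty.
Qed.

Lemma exch (C : smcat) (f g : mor C) a b c d :
  arrow a b f -> arrow c d g -> (b ⊗ g) ∘ (f ⊗ c) = (f ⊗ d) ∘ (a ⊗ g).
Proof. by move=> [<- <-] [<- <-]; exact: exchange. Qed.

Lemma Qbraid_mate (C : smcat) (P Q : ob C) (coev ev rcoev rev : mor C) X s :
  pivotal_pair P Q coev ev rcoev rev -> arrow (X ⊗ P) (P ⊗ X) s ->
  (X ⊗ ev) ∘ (Qbraid Q coev ev X s ⊗ P) = (ev ⊗ X) ∘ (Q ⊗ s).
Proof.
move=> [A1 A2 _ H _ _ _ _] As.
case: (A1) (A2) (As) => [d1 c1] [d2 c2] [ds cs]; rewrite /Qbraid.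
rewrite !tens_comp_r; try by ty.
rewrite !compA; try by ty.
have -> : (X ⊗ ev) ∘ (ev ⊗ X ⊗ Q ⊗ P) = (ev ⊗ X) ∘ (Q ⊗ P ⊗ X ⊗ ev).
  have := @exch _ (ev ⊗ X) ev (Q ⊗ P ⊗ X) X (Q ⊗ P) 𝟏.
  rewrite -!tmor_id !tmorA !tmorm1 => -> //; try by split; ty.
rewrite -[in X in X ∘ _]compA; try by ty.
have -> : (Q ⊗ P ⊗ X ⊗ ev) ∘ (Q ⊗ s ⊗ Q ⊗ P) = (Q ⊗ s) ∘ (Q ⊗ X ⊗ P ⊗ ev).
  have := @exch _ (Q ⊗ s) ev (Q ⊗ X ⊗ P) (Q ⊗ P ⊗ X) (Q ⊗ P) 𝟏.
  rewrite -!tmor_id !tmorA !tmorm1 => -> //; try by split; ty.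
rewrite -!compA; try by ty.
have -> : (Q ⊗ X ⊗ P ⊗ ev) ∘ (Q ⊗ X ⊗ coev ⊗ P) = (Q ⊗ X ⊗ P)%ob.
  rewrite -!tmor_id -!tmorA -tens_comp_l; first by ty.
  by rewrite -tens_comp_l ?H //; ty.
by rewrite (@comp_id_r _ (Q ⊗ s)) //; ty.
Qed.

Lemma Qbraid_unique (C : smcat) (P Q : ob C) (coev ev rcoev rev : mor C) X f :
  pivotal_pair P Q coev ev rcoev rev -> arrow (Q ⊗ X) (X ⊗ Q) f ->
  f = (((X ⊗ ev) ∘ (f ⊗ P)) ⊗ Q) ∘ (Q ⊗ X ⊗ coev).
Proof.
move=> [A1 A2 H _ _ _ _ _] Af.
case: (A1) (A2) (Af) => [d1 c1] [d2 c2] [df cf].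
rewrite tens_comp_r; first by ty.
rewrite -compA; try by ty.
have -> : (f ⊗ P ⊗ Q) ∘ (Q ⊗ X ⊗ coev) = (X ⊗ Q ⊗ coev) ∘ f.
  have := exch Af A1; rewrite -!tmor_id !tmorA !tmorm1 => -> //.
rewrite compA; try by ty.
rewrite -tmorA -(tmorA X Q) -tens_comp_l; first by ty.
by rewrite H tmor_id comp_id_l.
Qed.

Lemma Qbraid_inv_mate (C : smcat) (P Q : ob C) (coev ev rcoev rev : mor C)
    X s :
  pivotal_pair P Q coev ev rcoev rev -> arrow (P ⊗ X) (X ⊗ P) s ->
  (rev ⊗ X) ∘ (P ⊗ Qbraid_inv Q rcoev rev X s) = (X ⊗ rev) ∘ (s ⊗ Q).
Proof.
move=> [_ _ _ _ A1 A2 H _] As.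
case: (A1) (A2) (As) => [d1 c1] [d2 c2] [ds cs]; rewrite /Qbraid_inv.
rewrite !tens_comp_l; try by ty.
rewrite !compA; try by ty.
rewrite !tmorA.
have -> : (rev ⊗ X) ∘ (P ⊗ Q ⊗ X ⊗ rev) = (X ⊗ rev) ∘ (rev ⊗ X ⊗ P ⊗ Q).
  have := @exch _ rev (X ⊗ rev) (P ⊗ Q) 𝟏 (X ⊗ P ⊗ Q) X.
  rewrite -!tmor_id !tmorA !tmor1m => <- //; try by split; ty.
rewrite -[in X in X ∘ _]compA; try by ty.
have -> : (rev ⊗ X ⊗ P ⊗ Q) ∘ (P ⊗ Q ⊗ s ⊗ Q) = (s ⊗ Q) ∘ (rev ⊗ P ⊗ X ⊗ Q).
  have := @exch _ rev (s ⊗ Q) (P ⊗ Q) 𝟏 (P ⊗ X ⊗ Q) (X ⊗ P ⊗ Q).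
  rewrite -!tmor_id !tmorA !tmor1m => <- //; try by split; ty.
rewrite -!compA; try by ty.
have -> : (rev ⊗ P ⊗ X ⊗ Q) ∘ (P ⊗ rcoev ⊗ X ⊗ Q) = (P ⊗ X ⊗ Q)%ob.
  rewrite -!tens_comp_r; try by ty.
  by rewrite H !tmor_id.
by rewrite (@comp_id_r _ (s ⊗ Q)) //; ty.
Qed.

Lemma Qbraid_inv_unique (C : smcat) (P Q : ob C) (coev ev rcoev rev : mor C)
    X f :
  pivotal_pair P Q coev ev rcoev rev -> arrow (X ⊗ Q) (Q ⊗ X) f ->
  f = (Q ⊗ ((rev ⊗ X) ∘ (P ⊗ f))) ∘ (rcoev ⊗ X ⊗ Q).
Proof.
move=> [_ _ _ _ A1 A2 _ H] Af.
case: (A1) (A2) (Af) => [d1 c1] [d2 c2] [df cf].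
rewrite tens_comp_l; first by ty.
rewrite -compA; try by ty.
have -> : (Q ⊗ (P ⊗ f)) ∘ (rcoev ⊗ X ⊗ Q) = (rcoev ⊗ Q ⊗ X) ∘ f.
  have := exch A1 Af; rewrite -!tmor_id !tmorA !tmor1m => -> //.
rewrite compA; try by ty.
rewrite tmorA -tens_comp_r; first by ty.
by rewrite H tmor_id comp_id_l.
Qed.

Definition cpq_tens_sigma (C : smcat) (X Y : ob C) (s t : mor C) : mor C :=
  (s ⊗ Y) ∘ (X ⊗ t).

Lemma Qbraid_tens (C : smcat) (P Q : ob C) (coev ev rcoev rev : mor C)
    X Y s t :
  pivotal_pair P Q coev ev rcoev rev ->
  arrow (X ⊗ P) (P ⊗ X) s -> arrow (Y ⊗ P) (P ⊗ Y) t ->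
  Qbraid Q coev ev (X ⊗ Y) (cpq_tens_sigma X Y s t) =
  (X ⊗ Qbraid Q coev ev Y t) ∘ (Qbraid Q coev ev X s ⊗ Y).
Proof.
move=> pp As At; set f := RHS.
have Aq : arrow (X ⊗ Y ⊗ P) (P ⊗ (X ⊗ Y)) (cpq_tens_sigma X Y s t).
  by case: As At => [ds cs] [dt ct]; rewrite /cpq_tens_sigma; split; ty.
have AX := Qbraid_arrow pp As; have AY := Qbraid_arrow pp At.
have Af : arrow (Q ⊗ (X ⊗ Y)) (X ⊗ Y ⊗ Q) f.
  by case: AX AY => [dx cx] [dy cy]; rewrite /f; split; ty.
rewrite (Qbraid_unique pp (Qbraid_arrow pp Aq)) (Qbraid_mate pp Aq).
rewrite [RHS](Qbraid_unique pp Af); congr ((_ ⊗ _) ∘ _).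
have MX := Qbraid_mate pp As; have MY := Qbraid_mate pp At.
rewrite /f {f Af Aq}; move: AX AY MX MY.
move: (Qbraid _ _ _ _ s) (Qbraid _ _ _ _ t) => a b [da ca] [db cb] MX MY.
have [A1 A2 _ _ _ _ _ _] := pp.
case: (A2) (As) (At) => [d2 c2] [ds cs] [dt ct].
rewrite tens_comp_r; first by ty.
rewrite compA; try by ty.
rewrite -!tmor_id -!tmorA -tens_comp_l; first by ty.
rewrite MY tens_comp_l; first by ty.
rewrite -compA; try by ty.
have -> : (X ⊗ (Q ⊗ t)) ∘ (a ⊗ (Y ⊗ P)) = (a ⊗ (P ⊗ Y)) ∘ (Q ⊗ X ⊗ t).
  have := @exch _ a t (Q ⊗ X) (X ⊗ Q) (Y ⊗ P) (P ⊗ Y).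
  rewrite -!tmor_id !tmorA => -> //; try by split; ty.
rewrite !tmorA compA; try by ty.
rewrite -tens_comp_r; first by ty.
rewrite MX tens_comp_r; first by ty.
rewrite /cpq_tens_sigma tens_comp_l; first by ty.
by rewrite !tmorA compA //; ty.
Qed.

Lemma Qbraid_inv_tens (C : smcat) (P Q : ob C) (coev ev rcoev rev : mor C)
    X Y s t :
  pivotal_pair P Q coev ev rcoev rev ->
  arrow (P ⊗ X) (X ⊗ P) s -> arrow (P ⊗ Y) (Y ⊗ P) t ->
  Qbraid_inv Q rcoev rev (X ⊗ Y) ((X ⊗ t) ∘ (s ⊗ Y)) =
  (Qbraid_inv Q rcoev rev X s ⊗ Y) ∘ (X ⊗ Qbraid_inv Q rcoev rev Y t).
Proof.
move=> pp As At; set f := RHS.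
have Aq : arrow (P ⊗ (X ⊗ Y)) (X ⊗ Y ⊗ P) ((X ⊗ t) ∘ (s ⊗ Y)).
  by case: As At => [ds cs] [dt ct]; split; ty.
have AX := Qbraid_inv_arrow pp As; have AY := Qbraid_inv_arrow pp At.
have Af : arrow (X ⊗ Y ⊗ Q) (Q ⊗ (X ⊗ Y)) f.
  by case: AX AY => [dx cx] [dy cy]; rewrite /f; split; ty.
rewrite (Qbraid_inv_unique pp (Qbraid_inv_arrow pp Aq)) (Qbraid_inv_mate pp Aq).
rewrite [RHS](Qbraid_inv_unique pp Af); congr ((_ ⊗ _) ∘ _).
have MX := Qbraid_inv_mate pp As; have MY := Qbraid_inv_mate pp At.
rewrite /f {f Af Aq}; move: AX AY MX MY.
move: (Qbraid_inv _ _ _ _ s) (Qbraid_inv _ _ _ _ t).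
move=> a b [da ca] [db cb] MX MY.
have [_ _ _ _ A1 A2 _ _] := pp.
case: (A2) (As) (At) => [d2 c2] [ds cs] [dt ct].
rewrite (tens_comp_l P); first by ty.
rewrite compA; try by ty.
rewrite -!tmor_id !tmorA -tens_comp_r; first by ty.
rewrite MX (tens_comp_r Y); first by ty.
rewrite -compA; try by ty.
have -> : (s ⊗ Q ⊗ Y) ∘ (P ⊗ X ⊗ b) = (X ⊗ P ⊗ b) ∘ (s ⊗ Y ⊗ Q).
  have := @exch _ s b (P ⊗ X) (X ⊗ P) (Y ⊗ Q) (Q ⊗ Y).
  rewrite -!tmor_id !tmorA => -> //; try by split; ty.
rewrite compA; try by ty.
rewrite -!tmorA -tens_comp_l; first by ty.
rewrite MY tens_comp_l; first by ty.
rewrite tens_comp_r; first by ty.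
by rewrite -!tmorA compA //; ty.
Qed.

Lemma inverse_comp (C : category) (x y z : ob C) f f' g g' :
  inverse x y f f' -> inverse y z g g' -> inverse x z (g ∘ f) (f' ∘ g').
Proof.
move=> [[df cf] [df' cf'] e1 e2] [[dg cg] [dg' cg'] e3 e4].
split; try by split; rewrite ?dom_comp ?cod_comp ?df ?cg ?dg' ?cf' ?cf ?df'.
- rewrite compA ?dom_comp ?cod_comp ?df ?cg ?dg' ?cf' ?cf ?df' //.
  by rewrite -(@compA _ f' g' g) ?e3 ?comp_id_r ?df' ?cg' ?dg'.
- rewrite compA ?dom_comp ?cod_comp ?df ?cg ?dg' ?cf' ?cf ?df' //.
  by rewrite -(@compA _ g f f') ?e2 ?comp_id_r ?dg ?cf ?df.
Qed.

Lemma inverse_tens (C : smcat) (x y a b : ob C) f f' g g' :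
  inverse x y f f' -> inverse a b g g' ->
  inverse (x ⊗ a) (y ⊗ b) (f ⊗ g) (f' ⊗ g').
Proof.
move=> [[df cf] [df' cf'] e1 e2] [[dg cg] [dg' cg'] e3 e4].
split; try by split; ty.
- by rewrite -tmor_comp ?e1 ?e3 ?tmor_id ?df' ?dg'.
- by rewrite -tmor_comp ?e2 ?e4 ?tmor_id ?df ?dg.
Qed.

Lemma inverse_id (C : category) (x : ob C) : inverse x x x x.
Proof.
by split; rewrite ?comp_id_l ?cod_idm //; split; rewrite ?dom_idm ?cod_idm.
Qed.

Lemma is_cpq_tens (C : smcat) (P Q : ob C) (coev ev rcoev rev : mor C)
    X Y s t :
  pivotal_pair P Q coev ev rcoev rev ->
  is_cpq P Q coev ev rcoev rev X s -> is_cpq P Q coev ev rcoev rev Y t ->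
  is_cpq P Q coev ev rcoev rev (X ⊗ Y) (cpq_tens_sigma X Y s t).
Proof.
move=> pp [s' [Is IQs]] [t' [It IQt]]; exists ((X ⊗ t') ∘ (s' ⊗ Y)); split.
  rewrite -tobA; apply: (@inverse_comp _ _ (X ⊗ (P ⊗ Y))%ob).
    exact: inverse_tens (inverse_id X) It.
  by rewrite !tobA; exact: inverse_tens Is (inverse_id Y).
case: (Is) (It) => [As As' _ _] [At At' _ _].
rewrite (Qbraid_tens pp As At) (Qbraid_inv_tens pp As' At').
apply: (@inverse_comp _ _ (X ⊗ (Q ⊗ Y))%ob).
  by rewrite !tobA; exact: inverse_tens IQs (inverse_id Y).
by rewrite -tobA; exact: inverse_tens (inverse_id X) IQt.
Qed.

Lemma is_cpq_unit (C : smcat) (P Q : ob C) (coev ev rcoev rev : mor C) :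
  pivotal_pair P Q coev ev rcoev rev ->
  is_cpq P Q coev ev rcoev rev 𝟏 P.
Proof.
move=> [[d1 c1] [d2 c2] H1 _ [d3 c3] [d4 c4] _ H2]; exists P.
rewrite tob1x tobx1; split; first exact: inverse_id.
have -> : Qbraid Q coev ev 𝟏 P = Q.
  rewrite /Qbraid !tmorm1 tmor_id tmor_id (@comp_id_r _ (ev ⊗ Q)) //.
  by ty.
have -> : Qbraid_inv Q rcoev rev 𝟏 P = Q.
  rewrite /Qbraid_inv !tmorm1 tmor_id tmor_id (@comp_id_r _ (Q ⊗ rev)) //.
  by ty.
by rewrite tob1x tobx1; exact: inverse_id.
Qed.

Definition cpq_tens (C : smcat) (P Q : ob C) (coev ev rcoev rev : mor C)
    (pp : pivotal_pair P Q coev ev rcoev rev)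
    (a b : cpq_ob P Q coev ev rcoev rev) : cpq_ob P Q coev ev rcoev rev :=
  CpqOb (is_cpq_tens pp (cpq_law a) (cpq_law b)).

Definition cpq_unit (C : smcat) (P Q : ob C) (coev ev rcoev rev : mor C)
    (pp : pivotal_pair P Q coev ev rcoev rev) :
    cpq_ob P Q coev ev rcoev rev :=
  CpqOb (is_cpq_unit pp).

Lemma cpq_sigma_arrow (C : smcat) (P Q : ob C) (coev ev rcoev rev : mor C)
    (a : cpq_ob P Q coev ev rcoev rev) :
  arrow (cpq_carrier a ⊗ P) (P ⊗ cpq_carrier a) (cpq_sigma a).
Proof. by case: a => X s /= [s' [[]]]. Qed.

Program Definition cpq_structure (C : smcat) (P Q : ob C)
    (coev ev rcoev rev : mor C) (pp : pivotal_pair P Q coev ev rcoev rev) :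
    structure_over C :=
  @StructureOver C (cpq_ob P Q coev ev rcoev rev)
    (@cpq_carrier C P Q coev ev rcoev rev) (@cpq_hom C P Q coev ev rcoev rev)
    (cpq_tens pp) (cpq_unit pp) _ _ _ _ _ _ _ _ _.
Next Obligation. by case: H. Qed.
Next Obligation.
have [d c] := cpq_sigma_arrow a.
split; first by split; ty.
by rewrite !tmor_id comp_id_l ?comp_id_r.
Qed.
Next Obligation.
case: H H0 => [[dg cg] eg] [[df cf] ef].
have [da ca] := cpq_sigma_arrow a; have [db cb] := cpq_sigma_arrow b.
have [dc cc] := cpq_sigma_arrow c.
split; first by split; ty.
rewrite tens_comp_r ?dg // tens_comp_l ?dg // compA; try by ty.
by rewrite eg -compA ?ef ?compA //; ty.
Qed.
Next Obligation.
case: H H0 => [[df cf] ef] [[df' cf'] ef'].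
have [da ca] := cpq_sigma_arrow a; have [db cb] := cpq_sigma_arrow b.
have [da' ca'] := cpq_sigma_arrow a'; have [db' cb'] := cpq_sigma_arrow b'.
split=> /=; first by split; ty.
rewrite /cpq_tens_sigma.
rewrite -compA; try by ty.
have -> : (cpq_carrier b ⊗ cpq_sigma b') ∘ (f ⊗ f' ⊗ P) =
          (f ⊗ (P ⊗ f')) ∘ (cpq_carrier a ⊗ cpq_sigma a').
  rewrite -tmorA -tmor_comp; try by ty.
  rewrite ef' -tmor_comp; try by ty.
  by rewrite comp_id_l // comp_id_r.
rewrite compA; try by ty.
rewrite tmorA -tmor_comp; try by ty.
rewrite ef comp_id_l // -{1}(@comp_id_r _ f' (cpq_carrier a')) //.
rewrite tmor_comp; try by ty.
by rewrite -compA ?tmorA //; ty.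
Qed.
Next Obligation.
apply: cpq_ob_eq => /=; first exact: tobA.
have [da ca] := cpq_sigma_arrow a; have [db cb] := cpq_sigma_arrow b.
have [dc cc] := cpq_sigma_arrow c.
rewrite /cpq_tens_sigma tens_comp_l; first by ty.
rewrite tens_comp_r; first by ty.
by rewrite -!tmor_id !tmorA -compA ?compA //; ty.
Qed.
Next Obligation.
apply: cpq_ob_eq => /=; first exact: tob1x.
have [da ca] := cpq_sigma_arrow a.
by rewrite /cpq_tens_sigma tmor1m tmor_id comp_id_l.
Qed.
Next Obligation.
apply: cpq_ob_eq => /=; first exact: tobx1.
have [da ca] := cpq_sigma_arrow a.
by rewrite /cpq_tens_sigma tmorm1 tmor_id comp_id_r.
Qed.

Definition cpq (C : smcat) (P Q : ob C) (coev ev rcoev rev : mor C)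
    (pp : pivotal_pair P Q coev ev rcoev rev) : smcat :=
  sto_smcat (cpq_structure pp).

Definition cpq_forget (C : smcat) (P Q : ob C) (coev ev rcoev rev : mor C)
    (pp : pivotal_pair P Q coev ev rcoev rev) : smfunctor (cpq pp) C :=
  sto_smfunctor (cpq_structure pp).

Definition is_half_braiding (C : smcat) (X : ob C) (t : ob C -> mor C) :
    Prop :=
  [/\ nat_iso (tensor_left X) (tensor_right X) t,
      t 𝟏%ob = X &
      forall M N : ob C, (M ⊗ t N) ∘ (t M ⊗ N) = t (M ⊗ N)%ob].

Record center_ob (C : smcat) := CenterOb {
  center_carrier : ob C;
  center_braiding : ob C -> mor C;
  center_law : is_half_braiding center_carrier center_braiding
}.

Bind Scope ob_scope with center_ob.

Definition center_hom (C : smcat) (a b : center_ob C) (f : mor C) : Prop :=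
  arrow (center_carrier a) (center_carrier b) f /\
  forall N : ob C,
    (N ⊗ f) ∘ center_braiding a N = center_braiding b N ∘ (f ⊗ N).

Lemma center_ob_eq (C : smcat) (a b : center_ob C) :
  center_carrier a = center_carrier b ->
  (forall N, center_braiding a N = center_braiding b N) -> a = b.
Proof.
case: a b => [a s Hs] [b t Ht] /= e1 e2.
have {}e2 : s = t by apply: functional_extensionality.
by subst; congr CenterOb; apply: proof_irrelevance.
Qed.

Definition center_tens_braiding (C : smcat) (X Y : ob C)
    (s t : ob C -> mor C) (N : ob C) : mor C :=
  (s N ⊗ Y) ∘ (X ⊗ t N).

Lemma half_braiding_arrow (C : smcat) (X : ob C) t N :
  is_half_braiding X t -> arrow (X ⊗ N) (N ⊗ X) (t N).
Proof. by move=> [[[H _] _] _ _]; exact: H. Qed.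

Lemma half_braiding_inverse (C : smcat) (X : ob C) t N :
  is_half_braiding X t -> exists t', inverse (X ⊗ N) (N ⊗ X) (t N) t'.
Proof.
move=> H; have [d c] := half_braiding_arrow N H.
by case: H => [[_ /(_ N) [t' Ht]] _ _]; exists t'; rewrite -d -c.
Qed.

Lemma half_braiding_natural (C : smcat) (X : ob C) t f :
  is_half_braiding X t -> t (cod f) ∘ (X ⊗ f) = (f ⊗ X) ∘ t (dom f).
Proof. by move=> [[[_ H] _] _ _]; exact: H. Qed.

Lemma half_braiding_tens (C : smcat) (X Y : ob C) s t :
  is_half_braiding X s -> is_half_braiding Y t ->
  is_half_braiding (X ⊗ Y) (center_tens_braiding X Y s t).
Proof.
move=> Hs Ht.
have As N := half_braiding_arrow N Hs; have At N := half_braiding_arrow N Ht.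
have ds N : dom (s N) = _ := proj1 (As N).
have cs N : cod (s N) = _ := proj2 (As N).
have dt N : dom (t N) = _ := proj1 (At N).
have ct N : cod (t N) = _ := proj2 (At N).
have A N : arrow (X ⊗ Y ⊗ N) (N ⊗ (X ⊗ Y)) (center_tens_braiding X Y s t N).
  rewrite /center_tens_braiding.
  have := ds N; have := cs N; have := dt N; have := ct N => e1 e2 e3 e4.
  by split; ty.
split; first split.
- split=> [N|f] /=; first exact: A.
  rewrite /center_tens_braiding.
  have e1 := ds (dom f); have e2 := cs (dom f); have e3 := dt (dom f).
  have e4 := ct (dom f); have e5 := ds (cod f); have e6 := cs (cod f).
  have e7 := dt (cod f); have e8 := ct (cod f).
  rewrite -compA; try by ty.
  rewrite -!tmor_id -tmorA -tens_comp_l; first by ty.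
  rewrite half_braiding_natural // tens_comp_l; first by ty.
  rewrite compA; try by ty.
  rewrite !tmorA -tens_comp_r; first by ty.
  rewrite half_braiding_natural // tens_comp_r; first by ty.
  by rewrite -compA //; ty.
- move=> N; have [s' Is] := half_braiding_inverse N Hs.
  have [t' It] := half_braiding_inverse N Ht.
  rewrite /invertible; have [-> ->] := A N; exists ((X ⊗ t') ∘ (s' ⊗ Y)).
  apply: (@inverse_comp _ _ (X ⊗ (N ⊗ Y))%ob).
    by rewrite -tobA; exact: inverse_tens (inverse_id X) It.
  by rewrite !tobA; exact: inverse_tens Is (inverse_id Y).
- rewrite /center_tens_braiding; case: Hs Ht => [_ -> _] [_ -> _].
  by rewrite tmor_id comp_id_l ?cod_idm.
- move=> M N; rewrite /center_tens_braiding.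
  case: (Hs) (Ht) => [_ _ Es] [_ _ Et]; rewrite -Es -Et.
  have e1 := ds M; have e2 := cs M; have e3 := dt M.
  have e4 := ct M; have e5 := ds N; have e6 := cs N.
  have e7 := dt N; have e8 := ct N.
  rewrite !tens_comp_l; try by ty.
  rewrite !tens_comp_r; try by ty.
  rewrite !compA; try by ty.
  congr (_ ∘ _); last by rewrite tmorA.
  rewrite tmorA -!compA; try by ty.
  congr (_ ∘ _).
  have := exch (As M) (At N).
  by rewrite -!tmor_id !tmorA.
Qed.

Lemma half_braiding_unit (C : smcat) :
  is_half_braiding (𝟏%ob : ob C) (fun N => N : mor C).
Proof.
split=> //; first split.
- split=> [N|f] /=.
    by rewrite tob1x tobx1; split; rewrite ?dom_idm ?cod_idm.
  by rewrite tmor1m tmorm1 comp1m compm1.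
- move=> N; exists N; rewrite dom_idm cod_idm; exact: inverse_id.
- by move=> M N; rewrite !tmor_id comp_id_l ?cod_idm.
Qed.

Definition center_tens (C : smcat) (a b : center_ob C) : center_ob C :=
  CenterOb (half_braiding_tens (center_law a) (center_law b)).

Definition center_unit (C : smcat) : center_ob C :=
  CenterOb (half_braiding_unit C).

Program Definition center_structure (C : smcat) : structure_over C :=
  @StructureOver C (center_ob C) (@center_carrier C) (@center_hom C)
    (@center_tens C) (center_unit C) _ _ _ _ _ _ _ _ _.
Next Obligation. by case: H. Qed.
Next Obligation.
split=> [|N]; first by split; ty.
have [d c] := half_braiding_arrow N (center_law a).
by rewrite !tmor_id comp_id_l ?comp_id_r.
Qed.
Next Obligation.
case: H H0 => [[dg cg] eg] [[df cf] ef]; split=> [|N]; first by split; ty.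
have [da ca] := half_braiding_arrow N (center_law a).
have [db cb] := half_braiding_arrow N (center_law b).
have [dc cc] := half_braiding_arrow N (center_law c).
rewrite tens_comp_r ?dg // tens_comp_l ?dg // -compA; try by ty.
by rewrite ef compA ?eg -?compA //; ty.
Qed.
Next Obligation.
case: H H0 => [[df cf] ef] [[df' cf'] ef'].
split=> [|N] /=; first by split; ty.
have [da ca] := half_braiding_arrow N (center_law a).
have [db cb] := half_braiding_arrow N (center_law b).
have [da' ca'] := half_braiding_arrow N (center_law a').
have [db' cb'] := half_braiding_arrow N (center_law b').
rewrite /center_tens_braiding.
rewrite -[RHS]compA; try by ty.
have -> : (center_carrier b ⊗ center_braiding b' N) ∘ (f ⊗ f' ⊗ N) =
          (f ⊗ (N ⊗ f')) ∘ (center_carrier a ⊗ center_braiding a' N).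
  rewrite -tmorA -tmor_comp; try by ty.
  rewrite -ef' -tmor_comp; try by ty.
  by rewrite comp_id_l // comp_id_r.
rewrite [RHS]compA; try by ty.
rewrite [f ⊗ (N ⊗ f')]tmorA -[in RHS]tmor_comp; try by ty.
rewrite -ef comp_id_l // -[in RHS](@comp_id_r _ f' (center_carrier a')) //.
rewrite [in RHS]tmor_comp; try by ty.
by rewrite -compA ?tmorA //; ty.
Qed.
Next Obligation.
apply: center_ob_eq => [|N] /=; first exact: tobA.
have [da ca] := half_braiding_arrow N (center_law a).
have [db cb] := half_braiding_arrow N (center_law b).
have [dc cc] := half_braiding_arrow N (center_law c).
rewrite /center_tens_braiding /= /center_tens_braiding.
rewrite tens_comp_l; first by ty.
rewrite tens_comp_r; first by ty.
by rewrite -!tmor_id !tmorA -compA ?compA //; ty.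
Qed.
Next Obligation.
apply: center_ob_eq => [|N] /=; first exact: tob1x.
have [da ca] := half_braiding_arrow N (center_law a).
by rewrite /center_tens_braiding /= tmor1m tmor_id comp_id_l.
Qed.
Next Obligation.
apply: center_ob_eq => [|N] /=; first exact: tobx1.
have [da ca] := half_braiding_arrow N (center_law a).
by rewrite /center_tens_braiding /= tmorm1 tmor_id comp_id_r.
Qed.

Definition center (C : smcat) : smcat := sto_smcat (center_structure C).

Definition center_object (C : smcat) (X : ob C) (t : ob C -> mor C)
    (H : is_half_braiding X t) : ob (center C) := CenterOb H.

Definition center_mor (C : smcat) (a b : ob (center C)) (f : mor C)
    (H : center_hom a b f) : mor (center C) :=
  @StoMor C (center_structure C) a b f H.

Record comonoidal_monad_data (C : smcat) := ComonoidalMonadData {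
  cm_functor :> functor C C;
  cm_mu : ob C -> mor C;
  cm_nu : ob C -> mor C;
  cm_T2 : ob C -> ob C -> mor C;
  cm_T0 : mor C
}.

(* The monad T = UF with mu = U theta F and nu the unit, and the comonoidal
   structure induced by the strict monoidal functor U; the codomain of
   [adj_counit adj (F X ⊗ F Y)] lies over U F X ⊗ U F Y since U is strict. *)
Definition adj_monad (C D : smcat) (F : functor C D) (U : smfunctor D C)
    (adj : adjunction F U) : comonoidal_monad_data C :=
  {| cm_functor := comp_functor U F;
     cm_mu := fun X => fmor U (adj_counit adj (F X));
     cm_nu := adj_unit adj;
     cm_T2 := fun X Y => fmor U (adj_counit adj (F X ⊗ F Y)%ob) ∘
       fmor (comp_functor U F) (adj_unit adj X ⊗ adj_unit adj Y);
     cm_T0 := fmor U (adj_counit adj 𝟏%ob) |}.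

(* The witness is a bimonad morphism from T to the identity. *)
Definition augmented (C : smcat) (T : comonoidal_monad_data C) : Prop :=
  exists xi : ob C -> mor C,
    nat_trans T (id_functor C) xi /\
    (forall X : ob C, xi X ∘ cm_nu T X = X) /\
    (forall X : ob C, xi X ∘ cm_mu T X = xi X ∘ fmor T (xi X)) /\
    (forall X Y : ob C, (xi X ⊗ xi Y) ∘ cm_T2 T X Y = xi (X ⊗ Y)%ob) /\
    xi 𝟏%ob = cm_T0 T.

(* Main.v *)
From Stdlib Require Import ClassicalEpsilon.
From Corelib Require Import ssreflect ssrfun ssrbool.
Require Import Defs.

Set Implicit Arguments.
Unset Strict Implicit.
Unset Printing Implicit Defensive.

(** Both sides of the equivalence say the same thing: the forgetful functor
    [U : C(P,Q) -> C] has a strict monoidal section [X |-> (X, s X)], the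
    identity on morphisms.  Such a section is recorded by its family [s]
    ([monoidal_section]).

    Augmentations and sections.  A section [G] turns every object [X] into a
    [T]-algebra, with action the image under [U] of the counit at [G X]; these
    actions form a bimonad morphism to the identity because [G] is functorial
    and strict monoidal ([augmentation_of_section]).  Conversely, an
    augmentation [xi] makes each [X] a [T]-algebra, and the [T]-action lets the
    structure of the free object [F X] descend along [xi X : T X -> X]:
    [s X] is [(P ⊗ xi X) ∘ sigma_(F X) ∘ (nu X ⊗ P)], where [nu] is the unit of
    the adjunction.  That [xi X] intertwines [sigma_(F X)] and [s X] uses only
    that [sigma] is natural for the morphisms of C(P,Q) and that [xi] is an
    action ([descend_along_action]).  Since [xi X] is a split epimorphism of
    C, everything else descends with it: invertibility of [s X] and of the
    induced braiding with [Q] ([is_cpq_descend]), naturality, the unit law and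
    the tensor law ([cpq_hom_cancel], [section_of_augmentation]).

    Sections and the center.  The half-braiding of [P] is the inverse of [s],
    and the half-braiding of [Q] is [Qbraid] of [s].  The tensor law of the
    section is the hexagon of these half-braidings, and that [ev], [coev],
    [rev], [rcoev] are central is the mate correspondence between [s] and
    [Qbraid] ([center_of_section]).  Conversely, centrality of [ev] and [rev]
    forces the braidings of [Q] to be the mates of those of [P], which is the
    condition in the definition of C(P,Q) ([section_of_center]). *)

(** * Split epimorphisms and inverses *)

Lemma split_epi_cancel (C : category) (y : ob C) (e m g h : mor C) :
  dom e = cod m -> e ∘ m = y -> dom g = y -> dom h = y ->
  g ∘ e = h ∘ e -> g = h.
Proof.
move=> em eK dg dh E.
have ce : cod e = y by rewrite -(cod_comp em) eK cod_idm.
rewrite -(comp_id_r dg) -(comp_id_r dh) -eK !compA ?ce ?dg ?dh //.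
by rewrite E.
Qed.

(** Each of the two identities may be tested after precomposition with the
    split epimorphisms [d] and [e], where it becomes the corresponding identity
    between [f] and [f']. *)
Lemma inverse_descend (C : category) (x y x' y' : ob C)
    (d e m n f f' g g' : mor C) :
  arrow x x' d -> arrow x' x m -> d ∘ m = x' ->
  arrow y y' e -> arrow y' y n -> e ∘ n = y' ->
  arrow x' y' g -> arrow y' x' g' ->
  g ∘ d = e ∘ f -> g' ∘ e = d ∘ f' ->
  inverse x y f f' -> inverse x' y' g g'.
Proof.
move=> [dd cd] [dm cm] dK [de ce] [dn cn] eK [dg cg] [dg' cg'] E E'.
move=> [[df cf] [df' cf'] f'f ff']; split=> //.
- apply: (@split_epi_cancel _ x' d m); rewrite ?dd ?cm //;
    rewrite ?dom_comp ?dg ?dg' ?cg ?dom_idm //.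
  rewrite -compA ?dg ?dg' ?cg ?cd // E compA ?dg' ?ce ?de ?cf //.
  by rewrite E' -compA ?dd ?cf' ?df' ?cf // f'f comp_id_r // comp_id_l.
- apply: (@split_epi_cancel _ y' e n); rewrite ?de ?cn //;
    rewrite ?dom_comp ?dg ?dg' ?cg' ?dom_idm //.
  rewrite -compA ?dg ?dg' ?cg' ?ce // E' compA ?dg ?cd ?dd ?cf' //.
  by rewrite E -compA ?de ?cf ?df ?cf' // ff' comp_id_r // comp_id_l.
Qed.

Lemma inverse_natural (C : category) (x y x' y' : ob C)
    (f f' g g' a b : mor C) :
  inverse x y f f' -> inverse x' y' g g' -> arrow x x' a -> arrow y y' b ->
  g ∘ a = b ∘ f -> g' ∘ b = a ∘ f'.
Proof.
move=> [[df cf] [df' cf'] f'f ff'] [[dg cg] [dg' cg'] g'g gg'].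
move=> [da ca] [db cb] E.
rewrite -(comp_id_r db) -ff' (compA (h := b)) ?db ?cf ?df ?cf' // -E.
rewrite -(compA (h := g)) ?dg ?ca ?da ?cf' //.
by rewrite compA ?dom_comp ?cod_comp ?dg' ?cg ?dg ?ca ?da ?cf' // g'g
  comp_id_l // cod_comp ?da.
Qed.

Lemma inverse_unique (C : category) (x y : ob C) (f g g' : mor C) :
  inverse x y f g -> inverse x y f g' -> g = g'.
Proof.
move=> I I'; have := inverse_natural I I' => /(_ x y).
case: I I' => [_ [dg cg] _ _] [[df cf] [dg' cg'] _ _].
rewrite comp_id_r // comp_id_l // comp_id_r // comp_id_l // => -> //.
  by case: (inverse_id x).
by case: (inverse_id y).
Qed.

Lemma inverse_sym (C : category) (x y : ob C) (f g : mor C) :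
  inverse x y f g -> inverse y x g f.
Proof. by case. Qed.

(** * Naturality and mates of the braidings with Q *)

(** [Qbraid] is built from its argument by whiskering with duality morphisms,
    which slide past any [f]; hence a morphism of C(P,Q) is also compatible with
    the induced braidings with [Q]. *)
Lemma Qbraid_natural (C : smcat) (P Q : ob C) (coev ev rcoev rev : mor C)
    (X Y : ob C) (f s t : mor C) :
  pivotal_pair P Q coev ev rcoev rev -> arrow X Y f ->
  arrow (X ⊗ P) (P ⊗ X) s -> arrow (Y ⊗ P) (P ⊗ Y) t ->
  t ∘ (f ⊗ P) = (P ⊗ f) ∘ s ->
  Qbraid Q coev ev Y t ∘ (Q ⊗ f) = (f ⊗ Q) ∘ Qbraid Q coev ev X s.
Proof.
move=> [[d1 c1] [d2 c2] _ _ _ _ _ _] [df cf] [ds cs] [dt ct] E.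
rewrite /Qbraid -compA; try by ty.
have -> : (Q ⊗ Y ⊗ coev) ∘ (Q ⊗ f) = (Q ⊗ f ⊗ P ⊗ Q) ∘ (Q ⊗ X ⊗ coev).
  have := @exch _ (Q ⊗ f) coev (Q ⊗ X) (Q ⊗ Y) 𝟏 (P ⊗ Q).
  rewrite -!tmor_id !tmorA !tmorm1 => -> //; by split; ty.
rewrite -compA; try by ty.
rewrite (compA (h := Q ⊗ t ⊗ Q)); try by ty.
rewrite -tens_comp_r; first by ty.
rewrite -(tmorA Q f) -(tens_comp_l Q); first by ty.
rewrite E (tens_comp_l Q); first by ty.
rewrite tens_comp_r; first by ty.
rewrite !compA; try by ty.
congr (_ ∘ _ ∘ _).
have := @exch _ ev (f ⊗ Q) (Q ⊗ P) 𝟏 (X ⊗ Q) (Y ⊗ Q).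
rewrite -!tmor_id !tmorA !tmor1m => -> //; by split; ty.
Qed.

Lemma Qbraid_inv_natural (C : smcat) (P Q : ob C) (coev ev rcoev rev : mor C)
    (X Y : ob C) (f s t : mor C) :
  pivotal_pair P Q coev ev rcoev rev -> arrow X Y f ->
  arrow (P ⊗ X) (X ⊗ P) s -> arrow (P ⊗ Y) (Y ⊗ P) t ->
  t ∘ (P ⊗ f) = (f ⊗ P) ∘ s ->
  Qbraid_inv Q rcoev rev Y t ∘ (f ⊗ Q) = (Q ⊗ f) ∘ Qbraid_inv Q rcoev rev X s.
Proof.
move=> [_ _ _ _ [d1 c1] [d2 c2] _ _] [df cf] [ds cs] [dt ct] E.
rewrite /Qbraid_inv -compA; try by ty.
have -> : (rcoev ⊗ Y ⊗ Q) ∘ (f ⊗ Q) = (Q ⊗ (P ⊗ f) ⊗ Q) ∘ (rcoev ⊗ X ⊗ Q).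
  have := @exch _ rcoev (f ⊗ Q) 𝟏 (Q ⊗ P) (X ⊗ Q) (Y ⊗ Q).
  rewrite -!tmor_id !tmorA !tmor1m => -> //; by split; ty.
rewrite -compA; try by ty.
rewrite (compA (h := Q ⊗ t ⊗ Q)); try by ty.
rewrite -tens_comp_r; first by ty.
rewrite -(tens_comp_l Q); first by ty.
rewrite E (tens_comp_l Q); first by ty.
rewrite tens_comp_r; first by ty.
rewrite !compA; try by ty.
congr (_ ∘ _ ∘ _).
have := @exch _ (Q ⊗ f) rev (Q ⊗ X) (Q ⊗ Y) (P ⊗ Q) 𝟏.
rewrite -!tmor_id !tmorA !tmorm1 => -> //; by split; ty.
Qed.

(** A structure of C(P,Q) passes to the quotient by a split epimorphism of C as
    soon as [s] and its inverse do: the induced braidings with [Q] follow by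
    naturality, and inverses descend. *)
Lemma is_cpq_descend (C : smcat) (P Q : ob C) (coev ev rcoev rev : mor C)
    (X Y : ob C) (e m s s' t t' : mor C) :
  pivotal_pair P Q coev ev rcoev rev ->
  arrow X Y e -> arrow Y X m -> e ∘ m = Y ->
  inverse (X ⊗ P) (P ⊗ X) s s' ->
  inverse (Q ⊗ X) (X ⊗ Q) (Qbraid Q coev ev X s)
    (Qbraid_inv Q rcoev rev X s') ->
  arrow (Y ⊗ P) (P ⊗ Y) t -> arrow (P ⊗ Y) (Y ⊗ P) t' ->
  t ∘ (e ⊗ P) = (P ⊗ e) ∘ s -> t' ∘ (P ⊗ e) = (e ⊗ P) ∘ s' ->
  is_cpq P Q coev ev rcoev rev Y t.
Proof.
move=> pp Ae Am eK Is IQs At At' E E'.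
have [As As' _ _] := Is.
case: (Ae) (Am) => [de ce] [dm cm].
have KR (Z : ob C) : (e ⊗ Z) ∘ (m ⊗ Z) = (Y ⊗ Z)%ob.
  by rewrite -tens_comp_r ?eK ?tmor_id // de cm.
have KL (Z : ob C) : (Z ⊗ e) ∘ (Z ⊗ m) = (Z ⊗ Y)%ob.
  by rewrite -tens_comp_l ?eK ?tmor_id // de cm.
exists t'; split.
- apply: (inverse_descend _ _ (KR P) _ _ (KL P) _ _ E E' Is) => //;
    by split; ty.
- apply: (inverse_descend _ _ (KL Q) _ _ (KR Q) _ _
      (Qbraid_natural pp Ae As At E) (Qbraid_inv_natural pp Ae As' At' E') IQs);
    first [exact: Qbraid_arrow pp At | exact: Qbraid_inv_arrow pp At'
          | by split; ty].
Qed.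

(** The evaluation inside [Qbraid] meets [coev] in a zigzag for [P], which
    straightens.  With [Qbraid_mate] this shows that [coev] and [ev] are central
    for the same braidings. *)
Lemma coev_Qbraid (C : smcat) (P Q : ob C) (coev ev rcoev rev : mor C) X s :
  pivotal_pair P Q coev ev rcoev rev -> arrow (X ⊗ P) (P ⊗ X) s ->
  (P ⊗ Qbraid Q coev ev X s) ∘ (coev ⊗ X) = (s ⊗ Q) ∘ (X ⊗ coev).
Proof.
move=> [[d1 c1] [d2 c2] _ H _ _ _ _] [ds cs]; rewrite /Qbraid.
rewrite !(tens_comp_l P); try by ty.
rewrite -compA; try by ty.
have -> : (P ⊗ (Q ⊗ X ⊗ coev)) ∘ (coev ⊗ X) =
    (coev ⊗ (X ⊗ P ⊗ Q)) ∘ (X ⊗ coev).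
  have := @exch _ coev (X ⊗ coev) 𝟏 (P ⊗ Q) X (X ⊗ P ⊗ Q).
  rewrite -!tmor_id !tmorA !tmor1m => -> //; by split; ty.
rewrite -!compA; try by ty.
rewrite (compA (h := P ⊗ (Q ⊗ s ⊗ Q))); try by ty.
have -> : (P ⊗ (Q ⊗ s ⊗ Q)) ∘ (coev ⊗ (X ⊗ P ⊗ Q)) =
    (coev ⊗ P ⊗ (X ⊗ Q)) ∘ (s ⊗ Q).
  have := @exch _ coev (s ⊗ Q) 𝟏 (P ⊗ Q) (X ⊗ P ⊗ Q) (P ⊗ X ⊗ Q).
  rewrite -!tmor_id !tmorA !tmor1m => -> //; by split; ty.
rewrite !compA; try by ty.
rewrite -(tmorA ev) (tmorA P) tmor_id -(tens_comp_r (X ⊗ Q)); first by ty.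
by rewrite H tmor_id comp_id_l //; ty.
Qed.

(** The same straightening for the right duality, with the zigzag of [rev] and
    [rcoev]. *)
Lemma rcoev_Qbraid_inv (C : smcat) (P Q : ob C) (coev ev rcoev rev : mor C)
    X s :
  pivotal_pair P Q coev ev rcoev rev -> arrow (P ⊗ X) (X ⊗ P) s ->
  (Qbraid_inv Q rcoev rev X s ⊗ P) ∘ (X ⊗ rcoev) = (Q ⊗ s) ∘ (rcoev ⊗ X).
Proof.
move=> [_ _ _ _ [d1 c1] [d2 c2] H _] [ds cs]; rewrite /Qbraid_inv.
rewrite !(tens_comp_r P); try by ty.
rewrite -compA; try by ty.
have -> : (rcoev ⊗ X ⊗ Q ⊗ P) ∘ (X ⊗ rcoev) =
    ((Q ⊗ P ⊗ X) ⊗ rcoev) ∘ (rcoev ⊗ X).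
  have := @exch _ (rcoev ⊗ X) rcoev X (Q ⊗ P ⊗ X) 𝟏 (Q ⊗ P).
  rewrite -!tmor_id !tmorA !tmorm1 => -> //; by split; ty.
rewrite -!compA; try by ty.
rewrite (compA (h := Q ⊗ s ⊗ Q ⊗ P)); try by ty.
have -> : (Q ⊗ s ⊗ Q ⊗ P) ∘ ((Q ⊗ P ⊗ X) ⊗ rcoev) =
    ((Q ⊗ X) ⊗ (P ⊗ rcoev)) ∘ (Q ⊗ s).
  have := @exch _ (Q ⊗ s) rcoev (Q ⊗ P ⊗ X) (Q ⊗ X ⊗ P) 𝟏 (Q ⊗ P).
  rewrite -!tmor_id !tmorA !tmorm1 => -> //; by split; ty.
rewrite !compA; try by ty.
rewrite tmor_id -(tmorA (Q ⊗ X)%ob) -(tens_comp_l (Q ⊗ X)); first by ty.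
by rewrite H tmor_id comp_id_l //; ty.
Qed.

(** Mates determine each other, so the left duality leaves only one candidate
    for the braiding with [Q]. *)
Lemma Qbraid_of_mate (C : smcat) (P Q : ob C) (coev ev rcoev rev : mor C)
    X s q :
  pivotal_pair P Q coev ev rcoev rev -> arrow (X ⊗ P) (P ⊗ X) s ->
  arrow (Q ⊗ X) (X ⊗ Q) q -> (X ⊗ ev) ∘ (q ⊗ P) = (ev ⊗ X) ∘ (Q ⊗ s) ->
  Qbraid Q coev ev X s = q.
Proof.
move=> pp As Aq E; rewrite (Qbraid_unique pp (Qbraid_arrow pp As)).
by rewrite (Qbraid_mate pp As) -E -(Qbraid_unique pp Aq).
Qed.

Lemma Qbraid_inv_of_mate (C : smcat) (P Q : ob C) (coev ev rcoev rev : mor C)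
    X s q :
  pivotal_pair P Q coev ev rcoev rev -> arrow (P ⊗ X) (X ⊗ P) s ->
  arrow (X ⊗ Q) (Q ⊗ X) q -> (rev ⊗ X) ∘ (P ⊗ q) = (X ⊗ rev) ∘ (s ⊗ Q) ->
  Qbraid_inv Q rcoev rev X s = q.
Proof.
move=> pp As Aq E; rewrite (Qbraid_inv_unique pp (Qbraid_inv_arrow pp As)).
by rewrite (Qbraid_inv_mate pp As) -E -(Qbraid_inv_unique pp Aq).
Qed.

Lemma Qbraid_unit (C : smcat) (P Q : ob C) (coev ev rcoev rev : mor C) :
  pivotal_pair P Q coev ev rcoev rev -> Qbraid Q coev ev 𝟏 P = Q.
Proof.
move=> pp; apply: (Qbraid_of_mate pp).
- by rewrite tob1x tobx1; split; ty.
- by rewrite tob1x tobx1; split; ty.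
- by rewrite tmor1m tmorm1 !tmor_id.
Qed.

(** * Monoidal sections and the center *)

(** A strict monoidal section of the forgetful functor of C(P,Q) which is the
    identity on underlying morphisms; only the family of structure morphisms
    carries information. *)
Record monoidal_section (C : smcat) (P Q : ob C) (coev ev rcoev rev : mor C)
    (s : ob C -> mor C) : Prop := MonoidalSection {
  sec_cpq : forall X, is_cpq P Q coev ev rcoev rev X (s X);
  sec_natural : forall f, s (cod f) ∘ (f ⊗ P) = (P ⊗ f) ∘ s (dom f);
  sec_unit : s 𝟏%ob = P;
  sec_tens : forall X Y, s (X ⊗ Y)%ob = cpq_tens_sigma X Y (s X) (s Y)
}.

(** The section braids [X] past [P] in the direction opposite to that of the
    center, hence the inverse. *)
Lemma half_braiding_of_section (C : smcat) (P Q : ob C)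
    (coev ev rcoev rev : mor C) (s lam : ob C -> mor C) :
  monoidal_section P Q coev ev rcoev rev s ->
  (forall X, inverse (X ⊗ P) (P ⊗ X) (s X) (lam X)) ->
  is_half_braiding P lam.
Proof.
move=> [_ nat s1 sM] I.
split; first split.
- split=> [X|f] /=; first by case: (I X).
  by apply: (inverse_natural (I (dom f)) (I (cod f)) _ _ (nat f)); split; ty.
- move=> X; exists (s X); have [_ [-> ->] _ _] := I X; exact: inverse_sym.
- apply: (inverse_unique (I 𝟏%ob)); rewrite s1 tob1x tobx1.
  exact: inverse_id.
- move=> M N; apply: (inverse_unique _ (I (M ⊗ N)%ob)); rewrite sM.
  rewrite -tobA; apply: (@inverse_comp _ _ (M ⊗ (P ⊗ N))%ob).
    exact: inverse_tens (inverse_id M) (I N).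
  by rewrite !tobA; exact: inverse_tens (I M) (inverse_id N).
Qed.

Lemma half_braiding_Qbraid (C : smcat) (P Q : ob C)
    (coev ev rcoev rev : mor C) (s : ob C -> mor C) :
  pivotal_pair P Q coev ev rcoev rev ->
  monoidal_section P Q coev ev rcoev rev s ->
  is_half_braiding Q (fun X => Qbraid Q coev ev X (s X)).
Proof.
move=> pp [law nat s1 sM].
have A X : arrow (X ⊗ P) (P ⊗ X) (s X) by have [? [[]]] := law X.
split; first split.
- split=> [X|f] /=; first exact: Qbraid_arrow pp (A X).
  exact: (Qbraid_natural pp _ (A _) (A _) (nat f)).
- move=> X; have [s' [_ IQ]] := law X; exists (Qbraid_inv Q rcoev rev X s').
  by have [-> ->] := Qbraid_arrow pp (A X).
- by rewrite s1; exact: Qbraid_unit pp.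
- by move=> M N; rewrite sM (Qbraid_tens pp (A M) (A N)).
Qed.

Lemma center_of_section (C : smcat) (P Q : ob C) (coev ev rcoev rev : mor C)
    (s : ob C -> mor C) :
  pivotal_pair P Q coev ev rcoev rev ->
  monoidal_section P Q coev ev rcoev rev s ->
  exists (lam chi : ob C -> mor C)
         (Hlam : is_half_braiding P lam) (Hchi : is_half_braiding Q chi),
    let zP := center_object Hlam in
    let zQ := center_object Hchi in
    let z1 : ob (center C) := tunit in
    [/\ center_hom z1 (zP ⊗ zQ) coev, center_hom (zQ ⊗ zP) z1 ev,
        center_hom z1 (zQ ⊗ zP) rcoev & center_hom (zP ⊗ zQ) z1 rev].
Proof.
move=> pp sec.
pose inv X := constructive_indefinite_description _ (sec_cpq sec X).
pose lam X := proj1_sig (inv X).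
have I X : inverse (X ⊗ P) (P ⊗ X) (s X) (lam X) := proj1 (proj2_sig (inv X)).
have IQ X : inverse (Q ⊗ X) (X ⊗ Q) (Qbraid Q coev ev X (s X))
    (Qbraid_inv Q rcoev rev X (lam X)) := proj2 (proj2_sig (inv X)).
clearbody lam; clear inv.
exists lam, (fun X => Qbraid Q coev ev X (s X)).
exists (half_braiding_of_section sec I), (half_braiding_Qbraid pp sec).
have A X : arrow (X ⊗ P) (P ⊗ X) (s X) by case: (I X).
have A' X : arrow (P ⊗ X) (X ⊗ P) (lam X) by case: (I X).
have [[d1 c1] [d2 c2] _ _ [d3 c3] [d4 c4] _ _] := pp.
split; split => //= X; rewrite /center_tens_braiding;
  have [[ds cs] [dl cl] lK sK] := I X;
  have [[dq cq] [dq' cq'] q'K qK] := IQ X;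
  rewrite ?(@comp_id_l _ (_ ⊗ X)) ?(@comp_id_r _ (X ⊗ _)); try by ty.
- rewrite -compA; try by ty.
  rewrite (coev_Qbraid pp (A X)) compA; try by ty.
  by rewrite -tens_comp_r ?lK ?tmor_id ?comp_id_l //; ty.
- rewrite compA; try by ty.
  rewrite (Qbraid_mate pp (A X)) -compA; try by ty.
  rewrite -tens_comp_l; first by ty.
  by rewrite sK tmor_id comp_id_r //; ty.
- rewrite -compA; try by ty.
  rewrite -(rcoev_Qbraid_inv pp (A' X)) compA; try by ty.
  by rewrite -tens_comp_r ?qK ?tmor_id ?comp_id_l //; ty.
- rewrite compA; try by ty.
  rewrite -(Qbraid_inv_mate pp (A' X)) -compA; try by ty.
  rewrite -tens_comp_l; first by ty.
  by rewrite q'K tmor_id comp_id_r //; ty.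
Qed.

(** Centrality of [ev] says that [chi] is the mate of the inverse of [lam], and
    centrality of [rev] that the inverse of [chi] is the mate of [lam]; this is
    the defining condition of C(P,Q). *)
Lemma section_of_center (C : smcat) (P Q : ob C) (coev ev rcoev rev : mor C)
    (lam chi : ob C -> mor C)
    (Hlam : is_half_braiding P lam) (Hchi : is_half_braiding Q chi) :
  pivotal_pair P Q coev ev rcoev rev ->
  center_hom (center_tens (CenterOb Hchi) (CenterOb Hlam)) (center_unit C) ev ->
  center_hom (center_tens (CenterOb Hlam) (CenterOb Hchi)) (center_unit C)
    rev ->
  exists s, monoidal_section P Q coev ev rcoev rev s.
Proof.
move=> pp [_ Hev] [_ Hrev].
pose inv X := constructive_indefinite_description _
  (half_braiding_inverse X Hlam).
pose s X := proj1_sig (inv X).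
have I X : inverse (P ⊗ X) (X ⊗ P) (lam X) (s X) := proj2_sig (inv X).
have A X : arrow (X ⊗ P) (P ⊗ X) (s X) by case: (I X).
have [[[_ nat] _] lam1 lamM] := Hlam.
have [_ [d2 c2] _ _ _ [d4 c4] _ _] := pp.
exists s; split.
- move=> X; have [chi' Ichi] := half_braiding_inverse X Hchi.
  exists (lam X); split; first exact: inverse_sym.
  have [[dq cq] [dq' cq'] chi'K chiK] := Ichi.
  have [[dl cl] [ds cs] sK lamK] := I X.
  have {Hev} := Hev X; have {Hrev} := Hrev X.
  rewrite /= /center_tens_braiding !comp_id_l; try by ty.
  move=> Hrev Hev.
  have -> : Qbraid Q coev ev X (s X) = chi X.
    apply: (Qbraid_of_mate pp) => //; rewrite -Hev.
    rewrite -!compA; try by ty.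
    rewrite -tens_comp_l; first by ty.
    by rewrite lamK tmor_id comp_id_r //; ty.
  have -> : Qbraid_inv Q rcoev rev X (lam X) = chi'.
    apply: (Qbraid_inv_of_mate pp) => //; rewrite -Hrev.
    rewrite -!compA; try by ty.
    rewrite -tens_comp_l; first by ty.
    by rewrite chiK tmor_id comp_id_r //; ty.
  by [].
- move=> f.
  by apply: (inverse_natural (I (dom f)) (I (cod f)) _ _ (nat f)); split; ty.
- apply: (inverse_unique (I 𝟏%ob)); rewrite lam1 tob1x tobx1.
  exact: inverse_id.
- move=> M N; apply: (inverse_unique (I (M ⊗ N)%ob)); rewrite -lamM.
  rewrite tobA -[(M ⊗ N ⊗ P)%ob]tobA.
  apply: (@inverse_comp _ _ (M ⊗ (P ⊗ N))%ob).
    by rewrite !tobA; exact: inverse_tens (I M) (inverse_id N).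
  exact: inverse_tens (inverse_id M) (I N).
Qed.

(** The forgetful functor of a structure over C is faithful and strict
    monoidal, so the zigzag identities may be checked in C. *)
Lemma sto_pivotal_pair (C : smcat) (S : structure_over C)
    (P Q : ob (sto_smcat S)) (coev ev rcoev rev : mor (sto_smcat S)) :
  arrow 𝟏 (P ⊗ Q) coev -> arrow (Q ⊗ P) 𝟏 ev ->
  arrow 𝟏 (Q ⊗ P) rcoev -> arrow (P ⊗ Q) 𝟏 rev ->
  pivotal_pair (sto_forget P) (sto_forget Q) (sm_mor coev) (sm_mor ev)
    (sm_mor rcoev) (sm_mor rev) ->
  pivotal_pair P Q coev ev rcoev rev.
Proof.
have lift (f g h : mor (sto_smcat S)) (x y z : ob (sto_smcat S)) :
    arrow x y f -> arrow y z g -> arrow x z h ->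
    sm_mor g ∘ sm_mor f = sm_mor h -> g ∘ f = h.
  move=> [df cf] [dg cg] [dh ch] E.
  have gf : sm_dom g = sm_cod f by move: dg cf => /= -> ->.
  have [d c m] := @sto_mcompE C S g f gf.
  apply: sto_mor_eq; rewrite /= ?d ?c ?m //.
    by move: df dh => /= -> ->.
  by move: cg ch => /= -> ->.
move=> A1 A2 A3 A4 [_ _ E1 E2 _ _ E3 E4].
case: (A1) (A2) (A3) (A4) => [d1 c1] [d2 c2] [d3 c3] [d4 c4].
split=> //.
- by apply: (lift _ _ _ Q (Q ⊗ P ⊗ Q)%ob Q) => //; split; ty.
- by apply: (lift _ _ _ P (P ⊗ Q ⊗ P)%ob P) => //; split; ty.
- by apply: (lift _ _ _ P (P ⊗ Q ⊗ P)%ob P) => //; split; ty.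
- by apply: (lift _ _ _ Q (Q ⊗ P ⊗ Q)%ob Q) => //; split; ty.
Qed.

(** * From augmentations to monoidal sections *)

(** A [UF]-algebra inherits from its free resolution every structure [t] that
    is natural on D.  Write [T] for [UF] and [nu] for the unit.  Naturality of
    [nu] moves [xi X] past it as [T (xi X)], which
    commutes with [t] as it is the image of a morphism of D.  The action axiom
    replaces [xi X ∘ T (xi X)] by [xi X] after the multiplication, which also
    comes from D, and the multiplication then cancels against [nu]. *)
Lemma descend_along_action (C D E : category) (F : functor C D)
    (U : functor D C) (adj : adjunction F U) (A B : functor C E)
    (t : ob D -> mor E) (xi : ob C -> mor C) (X : ob C) :
  nat_trans (comp_functor A U) (comp_functor B U) t ->
  nat_trans (comp_functor U F) (id_functor C) xi ->
  xi X ∘ fmor U (adj_counit adj (F X)) = xi X ∘ fmor U (fmor F (xi X)) ->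
  (fmor B (xi X) ∘ t (F X) ∘ fmor A (adj_unit adj X)) ∘ fmor A (xi X) =
  fmor B (xi X) ∘ t (F X).
Proof.
move=> [At nt] [Ax nx] act.
have [Au nu] := adj_unit_nat adj; have [Ac nc] := adj_counit_nat adj.
have [dt ct] := At (F X); have [dx cx] := Ax X.
have [dt' ct'] := At (F (U (F X))).
have [du cu] := Au X; have [du' cu'] := Au (U (F X)).
have [dc cc] := Ac (F X).
move: dt ct dx cx dt' ct' du cu du' cu' dc cc => /=.
move=> dt ct dx cx dt' ct' du cu du' cu' dc cc.
have {}nu : adj_unit adj X ∘ xi X =
    fmor U (fmor F (xi X)) ∘ adj_unit adj (U (F X)).
  by have /= := nu (xi X); rewrite dx cx.
have nt1 := nt (fmor F (xi X)); have nt2 := nt (adj_counit adj (F X)).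
move: nt1 nt2; rewrite /= !dom_fmor !cod_fmor dx cx dc cc => nt1 nt2.
rewrite -[LHS]compA -?(fmor_comp A); try by ty.
rewrite nu (fmor_comp A); first by ty.
rewrite -compA; try by ty.
rewrite (compA (h := t (F X))); try by ty.
rewrite nt1 !compA; try by ty.
rewrite -(fmor_comp B); first by ty.
rewrite -act (fmor_comp B); first by ty.
rewrite -(compA (f := t (F (U (F X))))); try by ty.
rewrite -nt2 -!compA; try by ty.
rewrite -(fmor_comp A); first by ty.
by rewrite adj_triangle_r fmor_id comp_id_r.
Qed.

(** Being a morphism of C(P,Q) is an equation, and it can be tested after
    precomposition with a split epimorphism of C; the splitting [m] itself need
    not be a morphism of C(P,Q). *)
Lemma cpq_hom_cancel (C : smcat) (P Q : ob C) (coev ev rcoev rev : mor C)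
    (a b c : cpq_ob P Q coev ev rcoev rev) (e m g : mor C) :
  arrow (cpq_carrier b) (cpq_carrier a) m -> e ∘ m = cpq_carrier b ->
  arrow (cpq_carrier b) (cpq_carrier c) g ->
  cpq_hom a b e -> cpq_hom a c (g ∘ e) -> cpq_hom b c g.
Proof.
move=> [dm cm] eK [dg cg] [[de ce] He] [_ Hge]; split=> //.
have [da ca] := cpq_sigma_arrow a; have [db cb] := cpq_sigma_arrow b.
have [dc cc] := cpq_sigma_arrow c.
apply: (@split_epi_cancel _ (cpq_carrier b ⊗ P) (e ⊗ P) (m ⊗ P));
  try by ty.
  by rewrite -tens_comp_r ?eK ?tmor_id // de cm.
rewrite -!compA; try by ty.
rewrite -tens_comp_r ?dg ?ce // Hge tens_comp_l ?dg ?ce // He.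
by rewrite compA //; ty.
Qed.

Lemma cpq_mor_hom (C : smcat) (P Q : ob C) (coev ev rcoev rev : mor C)
    (pp : pivotal_pair P Q coev ev rcoev rev) (a b : ob (cpq pp))
    (f : mor (cpq pp)) :
  arrow a b f -> cpq_hom a b (sm_mor f).
Proof. by move=> [<- <-]; exact: (sm_hom f). Qed.

Lemma cpq_sigma_natural (C : smcat) (P Q : ob C) (coev ev rcoev rev : mor C)
    (pp : pivotal_pair P Q coev ev rcoev rev) :
  nat_trans (comp_functor (tensor_right P) (cpq_forget pp))
    (comp_functor (tensor_left P) (cpq_forget pp))
    (@cpq_sigma C P Q coev ev rcoev rev).
Proof.
split=> [a|f] /=; first exact: cpq_sigma_arrow.
by case: (sm_hom f).
Qed.

(** The structure on [X] is characterised as the only one making [xi X] a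
    morphism from [F X] in C(P,Q).  The unit and tensor laws follow: the bimonad
    axioms factor [xi 𝟏] and [xi (X ⊗ Y)] through morphisms of C(P,Q) to the
    unit and to the tensor product of the structures on [X] and [Y]. *)
Lemma section_of_augmentation (C : smcat) (P Q : ob C)
    (coev ev rcoev rev : mor C) (pp : pivotal_pair P Q coev ev rcoev rev)
    (F : functor C (cpq pp)) (adj : adjunction F (cpq_forget pp)) :
  augmented (adj_monad adj) ->
  exists s, monoidal_section P Q coev ev rcoev rev s.
Proof.
move=> [xi [xin [xiK [act [xiM xi1]]]]].
pose inv (a : ob (cpq pp)) := constructive_indefinite_description _ (cpq_law a).
pose sinv a := proj1_sig (inv a).
have I a := proj1 (proj2_sig (inv a)); have IQ a := proj2 (proj2_sig (inv a)).
rewrite -/(sinv _) in I IQ.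
have sinv_nat : nat_trans (comp_functor (tensor_left P) (cpq_forget pp))
    (comp_functor (tensor_right P) (cpq_forget pp)) sinv.
  split=> [a|f] /=; first by case: (I a).
  have [_ E] := sm_hom f; have Af := sto_arrow (sm_hom f).
  by apply: (inverse_natural (I _) (I _) _ _ E); case: Af => ? ?; split; ty.
have [Axi xi_nat] := xin.
have [Anu nu_nat] := adj_unit_nat adj; have [Ath th_nat] := adj_counit_nat adj.
(* Descent is applied to [sigma] and to its inverse separately; the two results
   are inverse to each other by [is_cpq_descend]. *)
pose s X := (P ⊗ xi X) ∘ cpq_sigma (F X) ∘ (adj_unit adj X ⊗ P).
pose s' X := (xi X ⊗ P) ∘ sinv (F X) ∘ (P ⊗ adj_unit adj X).
have As X : arrow (X ⊗ P) (P ⊗ X) (s X).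
  have [/= ? ?] := Axi X; have [/= ? ?] := Anu X.
  by have [? ?] := cpq_sigma_arrow (F X); rewrite /s; split; ty.
have As' X : arrow (P ⊗ X) (X ⊗ P) (s' X).
  have [/= ? ?] := Axi X; have [/= ? ?] := Anu X.
  by have [_ [? ?] _ _] := I (F X); rewrite /s'; split; ty.
have E X : s X ∘ (xi X ⊗ P) = (P ⊗ xi X) ∘ cpq_sigma (F X).
  exact: (descend_along_action (cpq_sigma_natural pp) xin (act X)).
have E' X : s' X ∘ (P ⊗ xi X) = (xi X ⊗ P) ∘ sinv (F X).
  exact: (descend_along_action sinv_nat xin (act X)).
have law X : is_cpq P Q coev ev rcoev rev X (s X).
  exact: (is_cpq_descend pp (Axi X) (Anu X) (xiK X) (I (F X)) (IQ (F X))
    (As X) (As' X) (E X) (E' X)).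
pose G X : ob (cpq pp) := CpqOb (law X).
have xi_hom X : cpq_hom (F X) (G X) (xi X).
  by split; [exact: Axi | exact: E].
(* Two structures on [X] for which [xi X] is a morphism from [F X] have the
   identity of [X] as a morphism between them, hence agree. *)
have sigma_eq (X : ob C) (b : ob (cpq pp)) :
    cpq_carrier b = X -> cpq_hom (F X) b (xi X) -> s X = cpq_sigma b.
  move=> eb Hb; have [db cb] := cpq_sigma_arrow b.
  have [ds cs] := As X; have [dx cx] := Axi X.
  have Aid : arrow X (cpq_carrier b) X by rewrite eb; split; ty.
  have Hid : cpq_hom (F X) b (X ∘ xi X) by rewrite comp_id_l.
  have [_] := cpq_hom_cancel (b := G X) (Anu X) (xiK X) Aid (xi_hom X) Hid.
  by rewrite /= !tmor_id comp_id_l ?comp_id_r // ?db ?eb.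
exists s; split=> //.
- move=> f; have Hf : cpq_hom (F (dom f)) (G (cod f)) (f ∘ xi (dom f)).
    have /= <- := xi_nat f.
    apply: (sto_comp (s := cpq_structure pp) (xi_hom (cod f))).
    by apply: cpq_mor_hom; split; ty.
  by have [] := cpq_hom_cancel (b := G (dom f)) (c := G (cod f)) (Anu _)
    (xiK _) (conj erefl erefl) (xi_hom _) Hf.
- apply: (sigma_eq _ (cpq_unit pp)) => //.
  by rewrite xi1; apply: (cpq_mor_hom (Ath 𝟏%ob)).
- move=> X Y.
  apply: (sigma_eq _ (cpq_tens pp (G X) (G Y))) => //; rewrite -xiM.
  apply: (sto_comp (s := cpq_structure pp) (b := cpq_tens pp (F X) (F Y))).
    exact: (sto_tmor (s := cpq_structure pp) (xi_hom X) (xi_hom Y)).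
  apply: (sto_comp (s := cpq_structure pp)).
    exact: (cpq_mor_hom (Ath (F X ⊗ F Y)%ob)).
  have [/= ? ?] := Anu X; have [/= ? ?] := Anu Y.
  by apply: cpq_mor_hom; split; ty.
Qed.

(** * From monoidal sections to augmentations *)

(** The components of the augmentation are the images of the counit at [G X].
    The unit law is a triangle identity.  Naturality, the action axiom and
    compatibility with [cm_T2] are the images under [U] of naturality of the
    counit at [G f], at the counit itself, and at a tensor product of two
    counits. *)
Lemma augmentation_of_section (C D : smcat) (F : functor C D)
    (U : smfunctor D C) (adj : adjunction F U) (G : functor C D) :
  (forall X : ob C, U (G X) = X) -> (forall f : mor C, fmor U (fmor G f) = f) ->
  G 𝟏%ob = 𝟏%ob -> (forall X Y : ob C, G (X ⊗ Y)%ob = (G X ⊗ G Y)%ob) ->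
  augmented (adj_monad adj).
Proof.
move=> UG UGf G1 GM.
have [Anu nu_nat] := adj_unit_nat adj; have [Ath th_nat] := adj_counit_nat adj.
pose th X := adj_counit adj (G X).
have dth X : dom (th X) = F X by case: (Ath (G X)) => [-> _] /=; rewrite UG.
have cth X : cod (th X) = G X by case: (Ath (G X)).
have dnu X : dom (adj_unit adj X) = X by case: (Anu X).
have cnu X : cod (adj_unit adj X) = U (F X) by case: (Anu X).
have dc a : dom (adj_counit adj a) = F (U a) by case: (Ath a).
have cc a : cod (adj_counit adj a) = a by case: (Ath a).
have xiK X : fmor U (th X) ∘ adj_unit adj X = X.
  by have := adj_triangle_r adj (G X); rewrite UG.
exists (fun X => fmor U (th X)); split; last split; last split; last split.
- split=> [X|f] /=; first by split; ty; rewrite ?dth ?cth ?UG.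
  have /= := th_nat (fmor G f); rewrite UGf dom_fmor cod_fmor -/(th _) => E.
  rewrite -[X in _ = X ∘ _]UGf -!(fmor_comp U) ?E //
    ?dth ?cth ?dom_fmor ?cod_fmor //.
- exact: xiK.
- move=> X /=; have /= := th_nat (th X).
  rewrite dth cth -/(th _) => E.
  by rewrite -!(fmor_comp U) ?E // ?cod_fmor ?dth ?cth ?cc ?dom_fmor ?UG.
- move=> X Y /=.
  have /= := th_nat (th X ⊗ th Y).
  rewrite dom_tmor cod_tmor !dth !cth -GM -/(th _) => E.
  rewrite compA; try by ty; rewrite ?dth ?cc ?dc ?cnu ?smf_ob.
  rewrite -smf_mor -(fmor_comp U); try by ty; rewrite !dth cc.
  rewrite -E (fmor_comp U); try by ty; rewrite dth !cth -GM UG.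
  rewrite -compA; try by ty; rewrite ?dth ?cth ?cnu ?smf_ob -?GM ?UG.
  rewrite -(fmor_comp U) -?(fmor_comp F);
    try by ty; rewrite ?dth ?cth ?cnu ?smf_ob.
  rewrite smf_mor -tmor_comp ?dom_fmor ?dth ?cnu // !xiK tmor_id !fmor_id.
  by rewrite comp_id_r // dom_fmor dth.
- by rewrite /= /th G1.
Qed.

Definition section_ob (C : smcat) (P Q : ob C) (coev ev rcoev rev : mor C)
    (pp : pivotal_pair P Q coev ev rcoev rev) (s : ob C -> mor C)
    (sec : monoidal_section P Q coev ev rcoev rev s) (X : ob C) :
    ob (cpq pp) :=
  CpqOb (sec_cpq sec X).

Definition section_mor (C : smcat) (P Q : ob C) (coev ev rcoev rev : mor C)
    (pp : pivotal_pair P Q coev ev rcoev rev) (s : ob C -> mor C)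
    (sec : monoidal_section P Q coev ev rcoev rev s) (f : mor C) :
    mor (cpq pp) :=
  @StoMor C (cpq_structure pp) (section_ob pp sec (dom f))
    (section_ob pp sec (cod f)) f
    (conj (conj erefl erefl) (sec_natural sec f)).

Program Definition section_functor (C : smcat) (P Q : ob C)
    (coev ev rcoev rev : mor C) (pp : pivotal_pair P Q coev ev rcoev rev)
    (s : ob C -> mor C) (sec : monoidal_section P Q coev ev rcoev rev s) :
    functor C (cpq pp) :=
  @Functor C (cpq pp) (section_ob pp sec) (section_mor pp sec) _ _ _ _.
Next Obligation.
by apply: sto_mor_eq; rewrite /= ?dom_idm ?cod_idm.
Qed.
Next Obligation.
have [|d c m] :=
    @sto_mcompE C _ (section_mor pp sec g) (section_mor pp sec f).
  by rewrite /= H.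
by apply: sto_mor_eq; rewrite /= ?d ?c ?m //= ?dom_comp ?cod_comp.
Qed.

(** * The characterisation of augmentations *)

Theorem theorem5p4 (C : smcat) (P Q : ob C) (coev ev rcoev rev : mor C)
    (pp : pivotal_pair P Q coev ev rcoev rev)
    (Hclosed : closed C) (Hcolim : has_countable_colimits C)
    (F : functor C (cpq pp)) (adj : adjunction F (cpq_forget pp)) :
  augmented (adj_monad adj) <->
  exists (lam chi : ob C -> mor C)
         (Hlam : is_half_braiding P lam) (Hchi : is_half_braiding Q chi),
    let zP := center_object Hlam in
    let zQ := center_object Hchi in
    let z1 : ob (center C) := tunit in
    exists (Hcoev : center_hom z1 (zP ⊗ zQ) coev)
           (Hev : center_hom (zQ ⊗ zP) z1 ev)
           (Hrcoev : center_hom z1 (zQ ⊗ zP) rcoev)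
           (Hrev : center_hom (zP ⊗ zQ) z1 rev),
      pivotal_pair zP zQ (center_mor Hcoev) (center_mor Hev)
        (center_mor Hrcoev) (center_mor Hrev).
Proof.
split=> [aug | [lam [chi [Hlam [Hchi [_ [Hev [_ [Hrev _]]]]]]]]].
- have [s sec] := section_of_augmentation aug.
  have [lam [chi [Hlam [Hchi [H1 H2 H3 H4]]]]] := center_of_section pp sec.
  exists lam, chi, Hlam, Hchi => zP zQ z1; exists H1, H2, H3, H4.
  exact: sto_pivotal_pair.
- have [s sec] := section_of_center pp Hev Hrev.
  apply: (@augmentation_of_section _ _ _ _ _ (section_functor pp sec)) => //.
  + by apply: cpq_ob_eq => //=; exact: (sec_unit sec).
  + by move=> X Y; apply: cpq_ob_eq => //=; exact: (sec_tens sec).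
Qed.
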